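(* Let $(G,\omega^+)$ be a symplectic Novikov Lie group with Lie algebra $\mathfrak{g}$, and let $\nabla^\omega$ be the symplectic connection on $G$ associated with the affine structure of $\omega^+$. For all $x,y\in\mathfrak{g}$: 1. The curvature tensor of $\nabla^{\omega}$ is given (at the neutral element) by $\mathcal{K}(x,y)=-\frac{2}{9}\mathrm{ad}_{[x,y]}$. In particular, $\nabla^\omega$ is flat if and only if $\mathfrak{g}$ is two-step nilpotent (i.e. $[[x,y],z]=0$ for all $x,y,z\in\mathfrak{g}$). 2. The Ricci tensor of $\nabla^\omega$ is given (at the neutral element) by $ric(x,y)=\frac{2}{9}\mathrm{tr}(\mathrm{ad}_x\circ\mathrm{ad}_y)$.
   Context: A symplectic Lie group $(G,\omega^+)$ is a real Lie group $G$ with a left-invariant symplectic form $\omega^+$. Let $\mathfrak{g}$ be its Lie algebra and $\omega=\omega^+(e)$, $e$ the unit. The left-symmetric product associated with $(\mathfrak{g},\omega)$ is the bilinear product defined by $\omega(x.y,z)=-\omega(y,[x,z])$; it is known to be left-symmetric with $x.y-y.x=[x,y]$. $(G,\omega^+)$ is a symplectic Novikov Lie group if $(x.y).z=(x.z).y$ for all $x,y,z\in\mathfrak{g}$. The affine structure associated to $\omega^+$ is the left-invariant connection $\nabla_{x^+}y^+=(x.y)^+$, where $x^+$ is the left-invariant vector field with value $x$ at $e$. The symplectic connection $\nabla^\omega$ associated with $\nabla$ is $\nabla^\omega_XY=\nabla_XY+\frac13\mathrm{N}(X,Y)+\frac13\mathrm{N}(Y,X)$, where $\mathrm{N}$ is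 the tensor defined by $(\nabla_X\omega^+)(Y,Z)=\omega^+(\mathrm{N}(X,Y),Z)$; it is left-invariant, torsion free and preserves $\omega^+$. On $\mathfrak{g}$ it is given by $\nabla^\omega_xy=\frac13(\mathrm{ad}_xy-\mathrm{ad}_x^*y)$, where $\mathrm{ad}_xy=[x,y]$ and $\mathrm{ad}_x^*$ is the symplectic adjoint, $\omega(\mathrm{ad}_xy,z)=\omega(y,\mathrm{ad}_x^*z)$. The curvature is $\mathcal{K}(x,y)=[\nabla^\omega_x,\nabla^\omega_y]-\nabla^\omega_{[x,y]}\in\mathfrak{gl}(\mathfrak{g})$, flat means $\mathcal{K}=0$, and the Ricci tensor is $ric(x,y)=\mathrm{tr}(z\mapsto\mathcal{K}(x,z)y)$. *)

(* Defs.v *)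
From HB Require Import structures.
From mathcomp Require Import all_boot all_order all_algebra.
From mathcomp Require Import all_classical all_reals all_analysis.
Set Implicit Arguments.
Unset Strict Implicit.
Unset Printing Implicit Defensive.
Import Order.TTheory GRing.Theory Num.Theory.
Import numFieldNormedType.Exports.
Local Open Scope classical_set_scope.
Local Open Scope ring_scope.

(* C^oo on a set U, meant for U open in a finite-dimensional space: all the
   iterated directional derivatives are differentiable at every point of U. *)
Definition iter_derive (R : realType) (V W : normedModType R)
    (s : seq V) (f : V -> W) : V -> W :=
  foldr (fun v g => 'D_v g) f s.

Definition smooth_on (R : realType) (V W : normedModType R)
    (U : set V) (f : V -> W) : Prop :=
  forall (s : seq V) (x : V), U x -> differentiable (iter_derive s f) x.

Record chart (R : realType) (n : nat) (T : topologicalType) := Chart {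
  chart_dom : set T;
  chart_map : T -> 'rV[R]_n;
  chart_inv : 'rV[R]_n -> T;
  chart_dom_open : open chart_dom;
  chart_cod_open : open (chart_map @` chart_dom);
  chart_mapK : forall p, chart_dom p -> chart_inv (chart_map p) = p;
  chart_map_cont : forall p, chart_dom p -> {for p, continuous chart_map};
  chart_inv_cont : forall u, (chart_map @` chart_dom) u ->
    {for u, continuous chart_inv}
}.

Definition chart_cod (R : realType) (n : nat) (T : topologicalType)
    (c : chart R n T) : set 'rV[R]_n := chart_map c @` chart_dom c.

Definition smooth_atlas (R : realType) (n : nat) (T : topologicalType)
    (A : set (chart R n T)) : Prop :=
  (forall p : T, exists2 c, A c & chart_dom c p) /\
  (forall c d, A c -> A d ->
     smooth_on [set u | chart_cod c u /\ chart_dom d (chart_inv c u)]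
               (chart_map d \o chart_inv c)).

#[short(type="groupTopologicalType")]
HB.structure Definition GroupTopological := {G of Group G & Topological G}.

Record lieGroup (R : realType) (n : nat) := LieGroup {
  lie_sort :> groupTopologicalType;
  lie_atlas : set (chart R n lie_sort);
  lie_hausdorff : hausdorff_space lie_sort;
  lie_second_countable : @second_countable lie_sort;
  lie_atlasP : smooth_atlas lie_atlas;
  lie_mul_cont : continuous (fun p : lie_sort * lie_sort => (p.1 * p.2)%g);
  lie_inv_cont : continuous (fun p : lie_sort => (p^-1)%g);
  lie_mul_smooth : forall a b c,
    lie_atlas a -> lie_atlas b -> lie_atlas c ->
    smooth_on
      [set uv : 'rV[R]_n * 'rV[R]_n | [/\ chart_cod a uv.1, chart_cod b uv.2 &
         chart_dom c (chart_inv a uv.1 * chart_inv b uv.2)%g]]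
      (fun uv => chart_map c (chart_inv a uv.1 * chart_inv b uv.2)%g);
  lie_inv_smooth : forall a c,
    lie_atlas a -> lie_atlas c ->
    smooth_on
      [set u : 'rV[R]_n | chart_cod a u /\ chart_dom c (chart_inv a u)^-1%g]
      (fun u => chart_map c (chart_inv a u)^-1%g)
}.

Section Geometry.
Variables (R : realType) (n : nat) (G : lieGroup R n).

Definition func : Type := G -> R^o.

Definition smooth (f : func) : Prop :=
  forall c, lie_atlas c -> smooth_on (chart_cod c) (f \o chart_inv c).

(* Tangent vectors and vector fields are represented by their action on
   functions.  This action is only meaningful on smooth functions; it is set
   to 0 on the other ones so that Leibniz equality of the representations is
   equality of vectors (resp. of vector fields). *)
Definition tvec : lmodType R := (func -> R^o : Type).
Definition vfield : lmodType R := (func -> (G -> R^o) : Type).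

Definition tangent (p : G) (v : tvec) : Prop :=
  (forall f, ~ smooth f -> v f = 0) /\
  exists c (w : 'rV[R]_n), [/\ lie_atlas c, chart_dom c p &
    forall f, smooth f -> v f = 'D_w (f \o chart_inv c) (chart_map c p)].

(* In each chart, X is the first-order operator \sum_i a_i d/du_i with smooth
   coefficients a = (a_i). *)
Definition vector_field (X : vfield) : Prop :=
  (forall f, ~ smooth f -> X f = 0) /\
  forall c, lie_atlas c -> exists a : 'rV[R]_n -> 'rV[R]_n,
    smooth_on (chart_cod c) a /\
    forall f u, smooth f -> chart_cod c u ->
      X f (chart_inv c u) = 'D_(a u) (f \o chart_inv c) u.

Definition at_point (X : vfield) (p : G) : tvec := fun f => X f p.

Definition bracket (X Y : vfield) : vfield := fun f => X (Y f) - Y (X f).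

Definition fscale (f : func) (X : vfield) : vfield :=
  fun h p => f p * X h p.

Definition ltrans (g : G) : G -> G := fun p => (g * p)%g.

Definition dltrans (g : G) (v : tvec) : tvec := fun f => v (f \o ltrans g).

Definition lpush (g : G) (X : vfield) : vfield :=
  fun f p => X (f \o ltrans g) (g^-1 * p)%g.

(* The Lie algebra is realised by left-invariant vector fields rather than by
   their values at the unit. *)
Definition lie_algebra : set vfield :=
  [set X | vector_field X /\ forall g, lpush g X = X].

Definition ad (X : vfield) : vfield -> vfield := bracket X.

Definition form2 : Type := G -> tvec -> tvec -> R.

Implicit Types om : form2.

Definition eval2 om (X Y : vfield) : func :=
  fun p => om p (at_point X p) (at_point Y p).

Definition differential_2form om : Prop :=
  [/\ forall p (a : R) v v' w, tangent p v -> tangent p v' -> tangent p w ->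
        om p (a *: v + v') w = a * om p v w + om p v' w,
      forall p (a : R) v w w', tangent p v -> tangent p w -> tangent p w' ->
        om p v (a *: w + w') = a * om p v w + om p v w',
      forall p v, tangent p v -> om p v v = 0 &
      forall X Y, vector_field X -> vector_field Y -> smooth (eval2 om X Y)].

Definition closed_form om : Prop :=
  forall X Y Z, vector_field X -> vector_field Y -> vector_field Z ->
    X (eval2 om Y Z) - Y (eval2 om X Z) + Z (eval2 om X Y)
    - eval2 om (bracket X Y) Z + eval2 om (bracket X Z) Y
    - eval2 om (bracket Y Z) X = 0.

Definition nondegenerate_form om : Prop :=
  forall p v, tangent p v ->
    (forall w, tangent p w -> om p v w = 0) -> v = 0.

Definition symplectic_form om : Prop :=
  [/\ differential_2form om, closed_form om & nondegenerate_form om].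

Definition left_invariant_form om : Prop :=
  forall g p v w, tangent p v -> tangent p w ->
    om (g * p)%g (dltrans g v) (dltrans g w) = om p v w.

Definition omega_e om (x y : vfield) : R :=
  om 1%g (at_point x 1%g) (at_point y 1%g).

(* This determines dot on the Lie algebra, since om is nondegenerate. *)
Definition left_symmetric_product om (dot : vfield -> vfield -> vfield) : Prop :=
  forall x y, lie_algebra x -> lie_algebra y ->
    lie_algebra (dot x y) /\
    forall z, lie_algebra z ->
      omega_e om (dot x y) z = - omega_e om y (bracket x z).

Definition novikov (dot : vfield -> vfield -> vfield) : Prop :=
  forall x y z, lie_algebra x -> lie_algebra y -> lie_algebra z ->
    dot (dot x y) z = dot (dot x z) y.

Definition affine_connection (nabla : vfield -> vfield -> vfield) : Prop :=
  [/\ forall X Y, vector_field X -> vector_field Y ->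
        vector_field (nabla X Y),
      forall f X X' Y, smooth f ->
        vector_field X -> vector_field X' -> vector_field Y ->
        nabla (fscale f X + X') Y = fscale f (nabla X Y) + nabla X' Y,
      forall X Y Y', vector_field X -> vector_field Y -> vector_field Y' ->
        nabla X (Y + Y') = nabla X Y + nabla X Y' &
      forall f X Y, smooth f -> vector_field X -> vector_field Y ->
        nabla X (fscale f Y) = fscale (X f) Y + fscale f (nabla X Y)].

Definition left_invariant_connection (nabla : vfield -> vfield -> vfield) :
    Prop :=
  forall g X Y, vector_field X -> vector_field Y ->
    nabla (lpush g X) (lpush g Y) = lpush g (nabla X Y).

Definition affine_structure (dot nabla : vfield -> vfield -> vfield) : Prop :=
  [/\ affine_connection nabla, left_invariant_connection nabla &
      forall x y, lie_algebra x -> lie_algebra y -> nabla x y = dot x y].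

Definition cov_deriv_form (nabla : vfield -> vfield -> vfield) om
    (X Y Z : vfield) : func :=
  X (eval2 om Y Z) - eval2 om (nabla X Y) Z - eval2 om Y (nabla X Z).

(* This determines N X Y, since om is nondegenerate. *)
Definition N_tensor om (nabla N : vfield -> vfield -> vfield) : Prop :=
  forall X Y, vector_field X -> vector_field Y ->
    vector_field (N X Y) /\
    forall Z, vector_field Z ->
      cov_deriv_form nabla om X Y Z = eval2 om (N X Y) Z.

Definition symplectic_connection (nabla N : vfield -> vfield -> vfield)
    (X Y : vfield) : vfield :=
  nabla X Y + (3%:R^-1 : R) *: N X Y + (3%:R^-1 : R) *: N Y X.

Definition curvature (nabla : vfield -> vfield -> vfield)
    (X Y Z : vfield) : vfield :=
  nabla X (nabla Y Z) - nabla Y (nabla X Z) - nabla (bracket X Y) Z.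

(* Meant for left-invariant connections, whose curvature tensor is determined
   by its values on left-invariant fields. *)
Definition flat (nabla : vfield -> vfield -> vfield) : Prop :=
  forall x y z, lie_algebra x -> lie_algebra y -> lie_algebra z ->
    curvature nabla x y z = 0.

Definition two_step_nilpotent : Prop :=
  forall x y z, lie_algebra x -> lie_algebra y -> lie_algebra z ->
    bracket (bracket x y) z = 0.

End Geometry.

Section Trace.
Variables (R : realType) (V : lmodType R) (g : set V).

Definition basis_of_subspace (m : nat) (e : 'I_m -> V) : Prop :=
  (forall i, g (e i)) /\
  forall x, g x -> exists! a : 'rV[R]_m, x = \sum_i a 0 i *: e i.

Definition has_trace (F : V -> V) (t : R) : Prop :=
  exists (m : nat) (e : 'I_m -> V) (A : 'M[R]_m),
    [/\ basis_of_subspace e, forall j, F (e j) = \sum_i A i j *: e i &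
        t = \tr A].

(* Trace of an endomorphism F of a finite-dimensional subspace g, computed in
   any basis (0 by convention when g is infinite dimensional). *)
Definition trace_on (F : V -> V) : R := xget 0 (has_trace F).

End Trace.

Definition ricci (R : realType) (n : nat) (G : lieGroup R n)
    (nabla : vfield G -> vfield G -> vfield G) (x y : vfield G) : R :=
  trace_on (@lie_algebra R n G) (fun z => curvature nabla x z y).

(* Main.v *)
(** Write L_x y = x.y and R_x y = y.x.  Testing the defining relation of N
    against left-invariant fields, which fill every tangent space, gives
    N(x, y) = - y.x on the Lie algebra, so that
    nabla^omega_x = (2 L_x - R_x) / 3.  Expanding the curvature with left
    symmetry and the Novikov identity (the right multiplications commute)
    leaves - 2/9 L_[x,y] + 1/9 R_[x,y], hence the formula amounts to
    R_[x,y] = 0, i.e. to [g, g] being isotropic.  To see this, put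
    s(w, x; z, y) = omega(w.z, x.y): it is antisymmetric in (w, x), and
    symmetric in (z, y) by the Novikov identity; left symmetry then says that
    its cyclic sum over w, x, z vanishes, and omega([x,y], [z,w]) is a
    combination of such cyclic sums.  The Ricci formula is the cyclicity of
    the trace applied to K(x, z) y = 2/9 ad_y (ad_x z). *)
Require Import Defs.
From HB Require Import structures.
From mathcomp Require Import all_boot all_order all_algebra.
From mathcomp Require Import all_classical all_reals all_analysis.
From mathcomp Require Import ring lra.
Set Implicit Arguments.
Unset Strict Implicit.
Unset Printing Implicit Defensive.
Import Order.TTheory GRing.Theory Num.Theory.
Import numFieldNormedType.Exports.
Local Open Scope classical_set_scope.
Local Open Scope ring_scope.

(** * Smooth maps *)

(** The first-order expansion of [f] at [x] is also one of [g], because the two maps agree near [x];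
    uniqueness of the differential then identifies both differentials. *)
Lemma near_eq_differentiable (R : realType) (V W : normedModType R)
    (f g : V -> W) (x : V) :
  (\near x, f x = g x) -> differentiable f x -> differentiable g x.
Proof.
move=> fg df; have fgx := nbhs_singleton fg.
have dg : g \o shift x = cst (g x) + 'd f x +o_ 0 id.
  have /eqaddoP := diff_locally df => h.
  apply/eqaddoP => e /h {}h.
  have : \forall y \near 0, f (y + x) = g (y + x).
    by move: fg; rewrite (near_shift 0 x) subr0.
  apply: filter_app2 h; near=> y => hy fgy.
  by move: hy; rewrite !fctE /= fgy fgx.
have dE : 'd g x = 'd f x :> (V -> W).
  by apply: diff_unique => //; exact: diff_continuous.
by apply/diff_locallyP; rewrite dE; split => //; exact: diff_continuous.
Unshelve. all: by end_near. Qed.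

Section Cdiff.
Context {R : realType}.

(* [Cdiff 0] is plain differentiability, so [Cdiff k] lies between C^k and
   C^k.+1. *)
Fixpoint Cdiff (V W : normedModType R) (k : nat) (U : set V) (f : V -> W) :
    Prop :=
  (forall x, U x -> differentiable f x) /\
  (if k is k'.+1 then forall v, Cdiff k' U ('D_v f) else True).

Lemma Cdiff_differentiable (V W : normedModType R) k (U : set V) (f : V -> W) :
  Cdiff k U f -> forall x, U x -> differentiable f x.
Proof. by case: k => [|k] []. Qed.

Lemma Cdiff0P (V W : normedModType R) (U : set V) (f : V -> W) :
  Cdiff 0 U f <-> forall x, U x -> differentiable f x.
Proof. by split=> [[]//|df]; split. Qed.

Lemma CdiffSP (V W : normedModType R) k (U : set V) (f : V -> W) :
  Cdiff k.+1 U f <->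
  (forall x, U x -> differentiable f x) /\ (forall v, Cdiff k U ('D_v f)).
Proof. by split. Qed.

Lemma Cdiff_derive (V W : normedModType R) k (U : set V) (f : V -> W) v :
  Cdiff k.+1 U f -> Cdiff k U ('D_v f).
Proof. by case=> _; apply. Qed.

Lemma CdiffW (V W : normedModType R) k (U : set V) (f : V -> W) :
  Cdiff k.+1 U f -> Cdiff k U f.
Proof.
elim: k f => [|k IH] f [df Df]; first exact/Cdiff0P.
by apply/CdiffSP; split=> [|v]; [exact: df|exact: IH (Df v)].
Qed.

Lemma iter_derive_rcons (V W : normedModType R) s v (f : V -> W) :
  iter_derive (rcons s v) f = iter_derive s ('D_v f).
Proof. by rewrite /iter_derive foldr_rcons. Qed.

(** [Cdiff] peels off the innermost derivative, which is the last entry of the list in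
    [iter_derive]; hence the induction from the right end. This form allows proofs of smoothness by
    induction on the order. *)
Lemma smooth_onP (V W : normedModType R) (U : set V) (f : V -> W) :
  smooth_on U f <-> forall k, Cdiff k U f.
Proof.
split=> [sf k|Cf s].
  elim: k f sf => [|k IH] f sf; first by apply/Cdiff0P; exact: (sf [::]).
  apply/CdiffSP; split=> [|v]; first exact: (sf [::]).
  apply: IH => s x Ux.
  by have := sf (rcons s v) x Ux; rewrite iter_derive_rcons.
elim/last_ind: s f Cf => [|s v IH] f Cf x Ux.
  exact: Cdiff_differentiable (Cf 0%N) x Ux.
by rewrite iter_derive_rcons; apply: IH Ux => k; exact: Cdiff_derive (Cf k.+1).
Qed.

(** As [U] is open, the maps agree near each of its points, so their derivatives agree on [U] as
    well. It allows a derivative to be replaced by a formula that is valid on [U] only. *)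
Lemma Cdiff_eq (V W : normedModType R) k (U : set V) (f g : V -> W) :
  open U -> (forall x, U x -> f x = g x) -> Cdiff k U f -> Cdiff k U g.
Proof.
move=> oU; elim: k f g => [|k IH] f g fg Cf.
  apply/Cdiff0P => x Ux.
  apply: near_eq_differentiable (Cdiff_differentiable Cf Ux).
  exact: (filterS fg (open_nbhs_nbhs (conj oU Ux))).
have nfg x : U x -> \near x, f x = g x.
  by move=> Ux; exact: (filterS fg (open_nbhs_nbhs (conj oU Ux))).
apply/CdiffSP; split=> [x Ux|v].
  exact: near_eq_differentiable (nfg x Ux) (Cdiff_differentiable Cf Ux).
apply: IH (Cdiff_derive v Cf) => x Ux; exact: near_eq_derive (nfg x Ux).
Qed.

Lemma Cdiff_local (V W : normedModType R) k (U : set V) (f : V -> W) :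
  (forall x, U x -> exists2 U', U' x & Cdiff k U' f) -> Cdiff k U f.
Proof.
elim: k f => [|k IH] f Uf.
  apply/Cdiff0P => x /Uf[U' U'x Cf]; exact: Cdiff_differentiable Cf x U'x.
apply/CdiffSP; split=> [x /Uf[U' U'x Cf]|v].
  exact: Cdiff_differentiable Cf x U'x.
apply: IH => x /Uf[U' U'x Cf]; exists U'; first exact: U'x.
exact: Cdiff_derive Cf.
Qed.

Lemma Cdiff_cst (V W : normedModType R) k (U : set V) (c : W) :
  Cdiff k U (cst c : V -> W).
Proof.
elim: k c => [|k IH] c.
  by apply/Cdiff0P => x _; exact: differentiable_cst.
apply/CdiffSP; split=> [x _|v]; first exact: differentiable_cst.
have -> : 'D_v (cst c : V -> W) = cst 0 by apply/funext => x; exact: derive_cst.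
exact: IH.
Qed.

Lemma CdiffD (V W : normedModType R) k (U : set V) (f g : V -> W) :
  open U -> Cdiff k U f -> Cdiff k U g -> Cdiff k U (f + g).
Proof.
move=> oU; elim: k f g => [|k IH] f g Cf Cg;
  have dfg x : U x -> differentiable (f + g) x by
    move=> Ux; apply: differentiableD;
    [exact: Cdiff_differentiable Cf x Ux|exact: Cdiff_differentiable Cg x Ux].
  exact/Cdiff0P.
apply/CdiffSP; split=> [|v]; first exact: dfg.
apply: (Cdiff_eq oU) (IH _ _ (Cdiff_derive v Cf) (Cdiff_derive v Cg)) => x Ux.
rewrite deriveD; first by [].
  exact/diff_derivable/(Cdiff_differentiable Cf).
exact/diff_derivable/(Cdiff_differentiable Cg).
Qed.

Lemma Cdiff_sum (V W : normedModType R) k (U : set V) n (f : 'I_n -> V -> W) :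
  open U -> (forall i, Cdiff k U (f i)) -> Cdiff k U (\sum_i f i).
Proof.
move=> oU Cf; apply: (big_ind (fun h => Cdiff k U h)).
- exact: Cdiff_cst.
- by move=> g h; exact: CdiffD.
- by move=> i _; exact: Cf.
Qed.

Lemma CdiffM (V : normedModType R) k (U : set V) (f g : V -> R) :
  open U -> Cdiff k U f -> Cdiff k U g -> Cdiff k U (f * g).
Proof.
move=> oU; elim: k f g => [|k IH] f g Cf Cg;
  have dfg x : U x -> differentiable (f * g) x by
    move=> Ux; apply: differentiableM;
    [exact: Cdiff_differentiable Cf x Ux|exact: Cdiff_differentiable Cg x Ux].
  exact/Cdiff0P.
apply/CdiffSP; split=> [|v]; first exact: dfg.
(* The Leibniz rule writes the derivative as two products; the factor left undifferentiated is
   lowered by one order to fit the induction hypothesis. *)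
have C1 := IH _ _ (CdiffW Cf) (Cdiff_derive v Cg).
have C2 := IH _ _ (CdiffW Cg) (Cdiff_derive v Cf).
apply: (Cdiff_eq oU) (CdiffD oU C1 C2) => x Ux.
rewrite deriveM; first by [].
  exact/diff_derivable/(Cdiff_differentiable Cf).
exact/diff_derivable/(Cdiff_differentiable Cg).
Qed.

Lemma Cdiff_scalel (V W : normedModType R) k (U : set V) (f : V -> R) (w : W) :
  open U -> Cdiff k U f -> Cdiff k U (fun x => f x *: w).
Proof.
move=> oU; elim: k f => [|k IH] f Cf;
  have df x : U x -> differentiable (fun x => f x *: w) x by
    move=> Ux; apply: differentiableZl; exact: Cdiff_differentiable Cf x Ux.
  exact/Cdiff0P.
apply/CdiffSP; split=> [|v]; first exact: df.
apply: (Cdiff_eq oU) (IH _ (Cdiff_derive v Cf)) => x Ux.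
rewrite deriveE; last exact: Cdiff_differentiable Cf x Ux.
rewrite deriveE; last exact: df.
by rewrite diffZl //; exact: Cdiff_differentiable Cf x Ux.
Qed.

Lemma derive_coord (V : normedModType R) n (h : V -> 'rV[R]_n) x v i :
  differentiable h x -> 'D_v (fun y => h y 0 i : R) x = ('D_v h x) 0 i.
Proof. by move=> dh; rewrite derive_mx ?mxE//; exact: diff_derivable. Qed.

Lemma differentiable_coords (V : normedModType R) n (h : V -> 'rV[R]_n) x i :
  differentiable h x -> differentiable (fun y => h y 0 i : R) x.
Proof.
move=> dh.
apply: (@differentiable_comp _ _ _ _ h (fun M : 'rV[R]_n => M 0 i : R)) => //.
exact: differentiable_coord.
Qed.

Lemma Cdiff_coord (V : normedModType R) k (U : set V) n (h : V -> 'rV[R]_n) i :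
  open U -> Cdiff k U h -> Cdiff k U (fun x => h x 0 i : R).
Proof.
move=> oU; elim: k h => [|k IH] h Ch;
  have dh x : U x -> differentiable (fun x => h x 0 i : R) x by
    move=> Ux; apply: differentiable_coords;
    exact: Cdiff_differentiable Ch x Ux.
  exact/Cdiff0P.
apply/CdiffSP; split=> [|v]; first exact: dh.
apply: (Cdiff_eq oU) (IH _ (Cdiff_derive v Ch)) => x Ux.
by rewrite derive_coord; [|exact: Cdiff_differentiable Ch x Ux].
Qed.

Lemma Cdiff_row (V : normedModType R) k (U : set V) n (h : V -> 'rV[R]_n) :
  open U -> (forall i, Cdiff k U (fun x => h x 0 i : R)) -> Cdiff k U h.
Proof.
move=> oU Ch.
have -> : h = \sum_i (fun x => h x 0 i *: delta_mx 0 i).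
  by apply/funext => x; rewrite fct_sumE {1}[h x]row_sum_delta.
by apply: (Cdiff_sum oU) => i; exact: (Cdiff_scalel _ oU).
Qed.

(** Linearity of the differential. It turns a derivative in a direction that varies with the point
    into a sum of products with partial derivatives in fixed directions, which [CdiffM] can
    treat. *)
Lemma derive_sum_delta (W : normedModType R) n (f : 'rV[R]_n -> W) x v :
  differentiable f x -> 'D_v f x = \sum_i v 0 i *: 'D_(delta_mx 0 i) f x.
Proof.
move=> df; rewrite deriveE// {1}[v]row_sum_delta linear_sum.
by apply: eq_bigr => i _; rewrite linearZ deriveE.
Qed.

Lemma derive_comp (V V' W : normedModType R) (h : V -> V')
    (f : V' -> W) x v :
  differentiable h x -> differentiable f (h x) ->
  'D_v (f \o h) x = 'D_('D_v h x) f (h x).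
Proof.
move=> dh df; rewrite [LHS]deriveE; last exact: differentiable_comp.
by rewrite diff_comp//= -!deriveE.
Qed.

(** By the chain rule the derivative of the composite along v is the sum over i of (D_v h)_i times
    (D_i f) o h, and the induction hypothesis applies to each (D_i f) o h. *)
Lemma Cdiff_comp (V : normedModType R) n k (U : set V) (U' : set 'rV[R]_n)
    (h : V -> 'rV[R]_n) (f : 'rV[R]_n -> R) :
  open U -> (forall x, U x -> U' (h x)) -> Cdiff k U h -> Cdiff k U' f ->
  Cdiff k U (f \o h).
Proof.
move=> oU UU'; elim: k f => [|k IH] f Ch Cf;
  have dh x : U x -> differentiable h x by
    exact: Cdiff_differentiable Ch x.
  apply/Cdiff0P => x Ux; apply: differentiable_comp; first exact: dh.
  by apply: Cdiff_differentiable Cf _ _; exact: UU'.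
have df x : U x -> differentiable f (h x).
  by move=> /UU'; exact: Cdiff_differentiable Cf _.
apply/CdiffSP; split=> [x Ux|v].
  by apply: differentiable_comp; [exact: dh|exact: df].
have C i : Cdiff k U
    ((fun x => ('D_v h x) 0 i : R) * ('D_(delta_mx 0 i) f \o h)).
  apply: (CdiffM oU).
    exact/(Cdiff_coord _ oU)/Cdiff_derive.
  exact: IH (CdiffW Ch) (Cdiff_derive _ Cf).
apply: (Cdiff_eq oU) (Cdiff_sum oU C) => x Ux.
rewrite derive_comp; [|exact: dh|exact: df].
by rewrite derive_sum_delta ?fct_sumE //; exact: df.
Qed.

End Cdiff.

(** * Symmetry of second derivatives *)

Section Schwarz.
Context {R : realType} {V : normedModType R}.
Implicit Types (g : V -> R) (x v w y : V).

Lemma is_derive_line g y w t : differentiable g (y + t *: w) ->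
  is_derive t 1 (fun t : R => g (y + t *: w)) ('D_w g (y + t *: w)).
Proof.
move=> dg.
have dZ : differentiable (fun t : R => t *: w) t.
  by apply: (@differentiableZl _ _ _ id w t); exact: ex_diff.
have lE : (fun t : R => y + t *: w) = cst y + (fun t : R => t *: w) by [].
have dl : differentiable (fun t : R => y + t *: w) t.
  by rewrite lE; apply: differentiableD; first exact: differentiable_cst.
have D1 : 'D_1 (fun t : R => y + t *: w) t = w.
  rewrite lE deriveD; [|exact: derivable_cst|exact: diff_derivable].
  rewrite derive_cst add0r deriveE// (@diffZl _ _ _ id w t)//.
  by rewrite diff_val scale1r.
apply: DeriveDef; first exact/diff_derivable/(differentiable_comp dl dg).
by rewrite (derive_comp _ dl dg) D1.
Qed.

Lemma MVT_line g y w h : 0 <= h ->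
  (forall t, 0 <= t <= h -> differentiable g (y + t *: w)) ->
  exists2 t, 0 <= t <= h & g (y + h *: w) - g y = h * 'D_w g (y + t *: w).
Proof.
move=> h0 dg.
have [||t t0h] := @MVT_segment R (fun t => g (y + t *: w))
    (fun t => 'D_w g (y + t *: w)) 0 h h0.
- move=> t; rewrite in_itv/= => /andP[/ltW t0 /ltW th].
  by apply: is_derive_line; apply: dg; rewrite t0.
- apply: continuous_in_subspaceT => t; rewrite inE/= in_itv/= => t0h.
  have [/derivable1_diffP dt _] := is_derive_line (dg _ t0h).
  exact: differentiable_continuous dt.
by rewrite scale0r addr0 subr0 mulrC => gE; exists t.
Qed.

(** Two applications of the mean value theorem: along [v] to the map z |-> g (z + h w) - g z, then
    along [w] to the derivative of [g] in direction [v]. *)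
Lemma second_difference g x v w h : 0 <= h ->
  (forall s t, 0 <= s <= h -> 0 <= t <= h ->
    differentiable g (x + s *: v + t *: w) /\
    differentiable ('D_v g) (x + s *: v + t *: w)) ->
  exists s t, [/\ 0 <= s <= h, 0 <= t <= h &
    g (x + h *: v + h *: w) - g (x + h *: v) - (g (x + h *: w) - g x) =
      h * h * 'D_w ('D_v g) (x + s *: v + t *: w)].
Proof.
move=> h0 dg; have hh : 0 <= h <= h by rewrite h0 lexx.
have zh : (0 : R) <= 0 <= h by rewrite h0 lexx.
have shiftE z : is_diff z (fun z => z + h *: w) id.
  have -> : (fun z => z + h *: w) = id + cst (h *: w) by [].
  rewrite -[X in is_diff _ _ X](addr0 id); exact: is_diffD.
have shiftD z : 'D_v (fun z => z + h *: w) z = v.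
  by rewrite deriveE ?diff_val//; exact: ex_diff.
have dgs s : 0 <= s <= h -> differentiable g (x + s *: v).
  by move=> sh; have [] := dg s 0 sh zh; rewrite scale0r addr0.
have dgh s : 0 <= s <= h ->
    differentiable (fun z => g (z + h *: w)) (x + s *: v).
  move=> sh; apply: (@differentiable_comp _ _ _ _ (fun z => z + h *: w) g).
    exact: ex_diff.
  by case: (dg s h sh hh).
have [s sh ->] : exists2 s, 0 <= s <= h &
    g (x + h *: v + h *: w) - g (x + h *: v) - (g (x + h *: w) - g x) =
    h * ('D_v g (x + s *: v + h *: w) - 'D_v g (x + s *: v)).
  have [s sh|s sh gE] := @MVT_line ((fun z => g (z + h *: w)) - g) x v h h0.
    by apply: differentiableB; [exact: dgh|exact: dgs].
  exists s => //; rewrite [LHS]gE; congr (h * _).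
  rewrite deriveB; [|exact/diff_derivable/dgh|exact/diff_derivable/dgs].
  congr (_ - _).
  rewrite (@derive_comp _ _ _ _ (fun z => z + h *: w) g); last 2 first.
  - exact: ex_diff.
  - by case: (dg s h sh hh).
  by rewrite shiftD.
have [t|t th ->] := @MVT_line ('D_v g) (x + s *: v) w h h0.
  by move=> th; case: (dg s t sh th).
by exists s, t; rewrite mulrA.
Qed.

(** The second difference is symmetric in [v] and [w], so the two mixed derivatives take a common
    value at points arbitrarily close to [x]. Order 2 in [Cdiff] makes the second derivatives
    differentiable, hence continuous, at [x]; a gap [e] between them would contradict this. *)
Lemma derive_swap g x v w (U : set V) : open U -> U x -> Cdiff 2 U g ->
  'D_v ('D_w g) x = 'D_w ('D_v g) x.
Proof.
move=> oU Ux C2.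
have C1 z := Cdiff_derive z C2.
have Dc z z' : {for x, continuous ('D_z ('D_z' g))}.
  apply: differentiable_continuous.
  exact: Cdiff_differentiable (Cdiff_derive z (C1 z')) x Ux.
apply/eqP/negPn/negP => neq.
set e := `|'D_v ('D_w g) x - 'D_w ('D_v g) x|.
have e0 : 0 < e by rewrite normr_gt0 subr_eq0.
have e20 : 0 < e / 2 by rewrite divr_gt0.
have /cvgrPdist_lt/(_ _ e20) c1 := Dc v w.
have /cvgrPdist_lt/(_ _ e20) c2 := Dc w v.
have [r /= r0 rP] := (nbhs_ballP x _).1
  (filterI (open_nbhs_nbhs (conj oU Ux)) (filterI c1 c2)).
have n0 : 0 < 1 + `|v| + `|w| by rewrite -addrA ltr_pwDl// addr_ge0.
(* With this side the whole parallelogram spanned at [x] by h v and h w lies in the ball of radius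
   [r]; the summand 1 keeps the denominator positive when both vectors vanish. *)
pose h := r / 2 / (1 + `|v| + `|w|).
have h0 : 0 < h by rewrite !divr_gt0.
have hP s t : 0 <= s <= h -> 0 <= t <= h -> ball x r (x + s *: v + t *: w).
  move=> /andP[s0 sh] /andP[t0 th]; rewrite -ball_normE/=.
  have -> : x - (x + s *: v + t *: w) = - (s *: v + t *: w).
    by rewrite -addrA opprD addrA subrr add0r.
  rewrite normrN (le_lt_trans (ler_normD _ _))// !normrZ.
  rewrite (ger0_norm s0) (ger0_norm t0).
  have hE : h * (1 + `|v| + `|w|) = r / 2 by rewrite /h divfK// gt_eqF.
  have sv : s * `|v| <= h * `|v| by rewrite ler_wpM2r.
  have tw : t * `|w| <= h * `|w| by rewrite ler_wpM2r.
  rewrite (le_lt_trans (lerD sv tw))// -mulrDr (@lt_trans _ _ (r / 2))//.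
    by rewrite -hE ltr_pM2l// -addrA ltrDr ltr01.
  by rewrite ltr_pdivrMr// ltr_pMr// ltr1n.
have hP' s t : 0 <= s <= h -> 0 <= t <= h -> ball x r (x + s *: w + t *: v).
  by move=> sh th; rewrite -addrA [s *: w + _]addrC addrA; exact: hP.
have dP z y : ball x r y -> differentiable g y /\ differentiable ('D_z g) y.
  move=> /rP[Uy _]; split; first exact: Cdiff_differentiable C2 y Uy.
  exact: Cdiff_differentiable (C1 z) y Uy.
have [s [t [sh th E1]]] := @second_difference g x v w h (ltW h0)
  (fun s t sh th => dP v _ (hP s t sh th)).
have [s' [t' [sh' th' E2]]] := @second_difference g x w v h (ltW h0)
  (fun s t sh th => dP w _ (hP' s t sh th)).
have [_ [_ B1]] := rP _ (hP s t sh th).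
have [_ [B2 _]] := rP _ (hP' s' t' sh' th').
have hh : h * h != 0 by rewrite mulf_neq0// gt_eqF.
(* Both sides, multiplied by h * h, are the same second difference of [g]. *)
have E : 'D_w ('D_v g) (x + s *: v + t *: w) =
         'D_v ('D_w g) (x + s' *: w + t' *: v).
  apply: (mulfI hh); apply: etrans (esym E1) _; apply: etrans _ E2.
  rewrite -(addrA x (h *: w)) [h *: w + _]addrC addrA.
  by rewrite !opprD !opprK !addrA [X in X + g x]addrAC.
have := ltrD B2 B1; rewrite -splitr -E.
by move=> /(le_lt_trans (ler_normB _ _)); rewrite opprB addrA subrK -/e ltxx.
Qed.
End Schwarz.

(** * Slices of maps of two variables *)

Section slice.
Context {R : realType} {V1 V2 W : normedModType R}.
Implicit Types H : V1 * V2 -> W.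

Lemma derive_slicel H b v u :
  'D_v (fun u => H (u, b)) u = 'D_(v, 0) H (u, b).
Proof.
rewrite /derive; set F := fun h : R => _; set F' := fun h : R => _.
suff -> : F = F' by [].
apply/funext => h; congr (_ *: (H _ - _)) => /=.
by congr pair; rewrite /= ?scaler0 ?add0r.
Qed.

Lemma derive_slicer H a v u :
  'D_v (fun u => H (a, u)) u = 'D_(0, v) H (a, u).
Proof.
rewrite /derive; set F := fun h : R => _; set F' := fun h : R => _.
suff -> : F = F' by [].
apply/funext => h; congr (_ *: (H _ - _)) => /=.
by congr pair; rewrite /= ?scaler0 ?add0r.
Qed.

Lemma iter_derive_slicel H b s :
  iter_derive s (fun u => H (u, b)) =
  (fun u => iter_derive [seq (v, 0) | v <- s] H (u, b)).
Proof.
elim: s => //= v s ->; apply/funext => u; exact: derive_slicel.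
Qed.

Lemma iter_derive_slicer H a s :
  iter_derive s (fun u => H (a, u)) =
  (fun u => iter_derive [seq (0, v) | v <- s] H (a, u)).
Proof.
elim: s => //= v s ->; apply/funext => u; exact: derive_slicer.
Qed.

Lemma smooth_on_slicel H b (U : set (V1 * V2)) :
  smooth_on U H -> smooth_on [set u | U (u, b)] (fun u => H (u, b)).
Proof.
move=> sH s u Uu; rewrite iter_derive_slicel.
apply: (@differentiable_comp _ _ _ _ (fun u => (u, b))
  (iter_derive [seq (v, 0) | v <- s] H)); last exact: sH.
by apply: differentiable_pair; [exact: ex_diff|exact: differentiable_cst].
Qed.

Lemma smooth_on_slicer H a (U : set (V1 * V2)) :
  smooth_on U H -> smooth_on [set u | U (a, u)] (fun u => H (a, u)).
Proof.
move=> sH s u Uu; rewrite iter_derive_slicer.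
apply: (@differentiable_comp _ _ _ _ (fun u => (a, u))
  (iter_derive [seq (0, v) | v <- s] H)); last exact: sH.
by apply: differentiable_pair; [exact: differentiable_cst|exact: ex_diff].
Qed.

End slice.

Lemma smooth_on_derive (R : realType) (V W : normedModType R) (U : set V)
    (f : V -> W) v : smooth_on U f -> smooth_on U ('D_v f).
Proof.
by move=> sf s x Ux; have := sf (rcons s v) x Ux; rewrite iter_derive_rcons.
Qed.

(** * Left translations and left-invariant fields *)

Lemma open_preimage_on (T T' : topologicalType) (U : set T) (D : set T')
    (h : T -> T') : open U -> open D ->
  (forall u, U u -> {for u, continuous h}) -> open [set u | U u /\ D (h u)].
Proof.
move=> oU oD hc; rewrite openE => u [Uu Du]; apply: filterI.
  exact: open_nbhs_nbhs (conj oU Uu).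
exact: (hc u Uu) _ (open_nbhs_nbhs (conj oD Du)).
Qed.

Section Charts.
Context {R : realType} {n : nat} {T : topologicalType}.
Implicit Types c : chart R n T.

Lemma chart_cod_map c p : chart_dom c p -> chart_cod c (chart_map c p).
Proof. by exists p. Qed.

Lemma chart_dom_inv c u : chart_cod c u -> chart_dom c (chart_inv c u).
Proof. by move=> [p cp <-]; rewrite chart_mapK. Qed.

Lemma chart_invK c u : chart_cod c u -> chart_map c (chart_inv c u) = u.
Proof. by move=> [p cp <-]; rewrite chart_mapK. Qed.

Lemma open_chart_cod c : open (chart_cod c).
Proof. exact: chart_cod_open. Qed.

End Charts.
Arguments open_chart_cod {R n T} c.

Section LieGroup.
Context {R : realType} {n : nat} (G : lieGroup R n).
Implicit Types (f h : func G) (X Y Z : vfield G) (p q g : G) (v w : tvec G).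

Lemma atlas_chart p : exists2 c, lie_atlas (l := G) c & chart_dom c p.
Proof. by have [+ _] := lie_atlasP G; exact. Qed.

Lemma smoothP f : smooth f <->
  forall c, lie_atlas c ->
    forall k, Cdiff k (chart_cod c) (f \o chart_inv c : _ -> R).
Proof. by split=> sf c /sf /smooth_onP. Qed.

Lemma smooth_differentiable f c u : smooth f -> lie_atlas c -> chart_cod c u ->
  differentiable (f \o chart_inv c : _ -> R) u.
Proof. by move=> sf ac cu; exact: (sf c ac [::] u cu). Qed.

Lemma smooth_cst (a : R) : smooth (cst a : func G).
Proof. by apply/smoothP => c _ k; exact: (@Cdiff_cst _ _ R). Qed.

Lemma smoothD f h : smooth f -> smooth h -> smooth (f + h : func G).
Proof.
move=> /smoothP sf /smoothP sh; apply/smoothP => c ac k.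
exact: (@CdiffD R _ R k (chart_cod c) (f \o chart_inv c) (h \o chart_inv c)
  (open_chart_cod c) (sf c ac k) (sh c ac k)).
Qed.

Lemma smoothZ (a : R) f : smooth f -> smooth (a *: (f : G -> R^o) : func G).
Proof.
move=> /smoothP sf; apply/smoothP => c ac k.
exact: (@CdiffM R _ k (chart_cod c) (cst a) (f \o chart_inv c)
  (open_chart_cod c)
  (Cdiff_cst _ _ _) (sf c ac k)).
Qed.

Definition ltrans_chart g (c d : chart R n G) : 'rV[R]_n -> 'rV[R]_n :=
  fun u => chart_map d (g * chart_inv c u)%g.

Definition ltrans_chart_dom g (c d : chart R n G) : set 'rV[R]_n :=
  [set u | chart_cod c u /\ chart_dom d (g * chart_inv c u)%g].

Lemma ltrans_continuous g : continuous (ltrans g).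
Proof.
move=> p.
apply: (@continuous_comp _ _ _ (fun q : G => (g, q))
  (fun q : G * G => (q.1 * q.2)%g)).
  by apply: cvg_pair => //=; exact: cvg_cst.
exact: lie_mul_cont.
Qed.

Lemma open_ltrans_chart_dom g c d : open (ltrans_chart_dom g c d).
Proof.
apply: (@open_preimage_on _ _ _ (chart_dom d) (fun u => (g * chart_inv c u)%g)).
- exact: open_chart_cod.
- exact: chart_dom_open.
move=> u cu; apply: (@continuous_comp _ _ _ (chart_inv c) (ltrans g)).
  exact: chart_inv_cont.
exact: ltrans_continuous.
Qed.

(** Left translation by [g] is the slice of the multiplication at the coordinates of [g] in a chart
    [a] around it. *)
Lemma ltrans_chart_smooth g c d : lie_atlas c -> lie_atlas d ->
  smooth_on (ltrans_chart_dom g c d) (ltrans_chart g c d).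
Proof.
move=> ac ad; have [a aa ag] := atlas_chart g.
move=> s u [cu du].
have := smooth_on_slicer (a := chart_map a g) (lie_mul_smooth aa ac ad) s.
have -> : (fun u => chart_map d (chart_inv a (chart_map a g, u).1 *
    chart_inv c (chart_map a g, u).2)%g) = ltrans_chart g c d.
  by apply/funext => y; rewrite /ltrans_chart /= chart_mapK.
by apply; split=> //=; [exact: chart_cod_map|rewrite chart_mapK].
Qed.

Lemma ltrans_chartE f g c d u : ltrans_chart_dom g c d u ->
  f (g * chart_inv c u)%g = (f \o chart_inv d \o ltrans_chart g c d) u.
Proof. by move=> [cu du]; rewrite /= /ltrans_chart chart_mapK. Qed.

(** Near a given point, the function read in [c] is [f] read in a chart [d] composed with
    [ltrans_chart g c d]. The chart [d] depends on the point, so the argument is local. *)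
Lemma smooth_ltrans g f : smooth f -> smooth (f \o ltrans g).
Proof.
move=> /smoothP sf; apply/smoothP => c ac k; apply: Cdiff_local => u cu.
have [d ad du] := atlas_chart (g * chart_inv c u)%g.
exists (ltrans_chart_dom g c d); first by split.
have /smooth_onP/(_ k) Cl := @ltrans_chart_smooth g c d ac ad.
have oU : open (ltrans_chart_dom g c d) by exact: open_ltrans_chart_dom.
have lcod y : ltrans_chart_dom g c d y -> chart_cod d (ltrans_chart g c d y).
  by move=> [_ dy]; exact: chart_cod_map.
apply: (Cdiff_eq oU) (Cdiff_comp oU lcod Cl (sf d ad k)) => y Uy.
by rewrite -ltrans_chartE.
Qed.

Lemma ltransM f g g' : f \o ltrans g \o ltrans g' = f \o ltrans (g * g')%g.
Proof. by apply/funext => p; rewrite /= /ltrans mulgA. Qed.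

Lemma ltrans1 f : f \o ltrans 1%g = f.
Proof. by apply/funext => p; rewrite /= /ltrans mul1g. Qed.

(** Tangent vectors and fields vanish on functions that are not smooth; the equivalence shows that
    left translation respects this convention. *)
Lemma smooth_ltransP g f : smooth (f \o ltrans g) <-> smooth f.
Proof.
split=> [/(smooth_ltrans g^-1%g)|]; last exact: smooth_ltrans.
by rewrite ltransM mulgV ltrans1.
Qed.

Lemma derive_ltrans_chart f g c d p (w : 'rV[R]_n) : smooth f ->
  lie_atlas c -> lie_atlas d -> chart_dom c p -> chart_dom d (g * p)%g ->
  'D_w (f \o ltrans g \o chart_inv c) (chart_map c p) =
  'D_('D_w (ltrans_chart g c d) (chart_map c p)) (f \o chart_inv d)
    (chart_map d (g * p)%g).
Proof.
move=> sf ac ad cp dp.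
have Up : ltrans_chart_dom g c d (chart_map c p).
  by split; [exact: chart_cod_map|rewrite chart_mapK].
have lE : chart_map d (g * p)%g = ltrans_chart g c d (chart_map c p).
  by rewrite /ltrans_chart chart_mapK.
rewrite lE -derive_comp; last 2 first.
- exact: (@ltrans_chart_smooth g c d ac ad [::]).
- by apply: smooth_differentiable; rewrite -?lE//; exact: chart_cod_map.
apply: near_eq_derive.
have oU : open (ltrans_chart_dom g c d) by exact: open_ltrans_chart_dom.
apply: filterS (open_nbhs_nbhs (conj oU Up)) => u Uu.
by rewrite -ltrans_chartE.
Qed.

Lemma tangent_dltrans g p v : tangent p v -> tangent (g * p)%g (dltrans g v).
Proof.
move=> [v0 [c [w [ac cp vE]]]]; split.
  by move=> f sf; apply: v0; rewrite smooth_ltransP.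
have [d ad dp] := atlas_chart (g * p)%g.
exists d, ('D_w (ltrans_chart g c d) (chart_map c p)); split=> // f sf.
by rewrite /dltrans vE; [exact: derive_ltrans_chart|exact: smooth_ltrans].
Qed.

(** The value at [q] is [dltrans q v]: for [v] tangent at the unit, this is the left-invariant field
    extending [v]. *)
Definition left_field v : vfield G := fun f q => v (f \o ltrans q).

(** Left invariance is associativity. In a chart the coefficient map at [u] is the derivative, in
    direction (0, w), of the multiplication at [u] and the coordinates of the unit, and is therefore
    smooth in [u]. *)
Lemma left_field_lie_algebra v : tangent 1%g v -> lie_algebra (left_field v).
Proof.
move=> [v0 [b [w [ab b1 vE]]]]; split; last first.
  move=> g; apply/funext => f; apply/funext => p.
  by rewrite /lpush /left_field ltransM mulVKg.
split=> [f sf|c ac].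
  by apply/funext => q; rewrite /left_field v0// smooth_ltransP.
pose F (uv : 'rV[R]_n * 'rV[R]_n) :=
  chart_map c (chart_inv c uv.1 * chart_inv b uv.2)%g.
pose a (u : 'rV[R]_n) :=
  'D_w (ltrans_chart (chart_inv c u) b c) (chart_map b 1%g).
have aE : a = fun u => 'D_(0, w) F (u, chart_map b 1%g).
  by apply/funext => u; rewrite -derive_slicer.
have codb : chart_cod b (chart_map b 1%g) by exact: chart_cod_map.
exists a; split.
  have := smooth_on_derive (0, w) (lie_mul_smooth ac ab ac).
  move=> /(smooth_on_slicel (b := chart_map b 1%g)); rewrite aE => sa s u cu.
  apply: sa; split=> //=; rewrite chart_mapK// mulg1; exact: chart_dom_inv.
move=> f u sf cu.
rewrite /left_field vE; last exact: smooth_ltrans.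
rewrite (@derive_ltrans_chart _ _ _ c)// ?mulg1 ?chart_invK//.
exact: chart_dom_inv.
Qed.

(** The vector is carried to the unit by the translation by the inverse of [p], then extended.
    Pointwise statements can thus be tested on left-invariant fields alone. *)
Lemma left_field_extension p v : tangent p v ->
  exists2 Z, lie_algebra Z & at_point Z p = v.
Proof.
move=> /(tangent_dltrans p^-1%g); rewrite mulVg => tv.
exists (left_field (dltrans p^-1%g v)); first exact: left_field_lie_algebra.
apply/funext => f.
by rewrite /at_point /left_field /dltrans ltransM mulgV ltrans1.
Qed.

Lemma vector_field_tangent X p : vector_field X -> tangent p (at_point X p).
Proof.
move=> [X0 XP]; split=> [f sf|]; first by rewrite /at_point X0.
have [c ac cp] := atlas_chart p.
have [a [_ aE]] := XP c ac.
exists c, (a (chart_map c p)); split=> // f sf.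
by rewrite -aE//; [rewrite chart_mapK|exact: chart_cod_map].
Qed.

Lemma vfield_eq X Y : (forall f, ~ smooth f -> X f = Y f) ->
  (forall f, smooth f -> X f = Y f) -> X = Y.
Proof.
by move=> H1 H2; apply/funext => f; have [/H2|/H1] := pselect (smooth f).
Qed.

End LieGroup.

(** * Symplectic Novikov algebras *)

Section Algebra.
Context {R : realType} {V : lmodType R}.

(** The algebraic content of the hypotheses at the unit. The algebra is a subset [g] of a larger
    module because the Lie algebra sits inside the space of all fields; [sna_closed] is closedness
    of the form without its derivative terms, which vanish on left-invariant fields. *)
Record symplectic_novikov_algebra (g : set V) (br dot : V -> V -> V)
    (om : V -> V -> R) : Prop := {
  sna_lin : forall (a : R) x y, g x -> g y -> g (a *: x + y);
  sna_br : forall x y, g x -> g y -> g (br x y);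
  sna_dot : forall x y, g x -> g y -> g (dot x y);
  sna_brC : forall x y, br x y = - br y x;
  sna_brl : forall (a : R) x y z, g x -> g y -> g z ->
    br (a *: x + y) z = a *: br x z + br y z;
  sna_jacobi : forall x y z, g x -> g y -> g z ->
    br x (br y z) = br (br x y) z + br y (br x z);
  sna_oml : forall (a : R) x y z, g x -> g y -> g z ->
    om (a *: x + y) z = a * om x z + om y z;
  sna_omC : forall x y, g x -> g y -> om x y = - om y x;
  sna_nondeg : forall x, g x -> (forall z, g z -> om x z = 0) -> x = 0;
  sna_closed : forall x y z, g x -> g y -> g z ->
    om (br x y) z - om (br x z) y + om (br y z) x = 0;
  sna_dotE : forall x y z, g x -> g y -> g z ->
    om (dot x y) z = - om y (br x z);
  sna_novikov : forall x y z, g x -> g y -> g z ->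
    dot (dot x y) z = dot (dot x z) y
}.

(** This is x.y - (y.x + x.y) / 3, the symplectic connection after substituting N(x, y) = - y.x. *)
Definition sna_nabla (dot : V -> V -> V) x y : V :=
  (2 / 3 : R) *: dot x y + (- 3^-1 : R) *: dot y x.

Context {g : set V} {br dot : V -> V -> V} {om : V -> V -> R}.
Hypothesis H : symplectic_novikov_algebra g br dot om.

Let gL := sna_lin H.
Let gbr := sna_br H.
Let gdot := sna_dot H.
Let brC := sna_brC H.
Let brl := sna_brl H.
Let jacobi := sna_jacobi H.
Let oml := sna_oml H.
Let omC := sna_omC H.
Let dotE := sna_dotE H.
Let novikov := sna_novikov H.

Lemma sna_g0 x : g x -> g 0.
Proof. by move=> gx; have := gL (-1) gx gx; rewrite scaleN1r addNr. Qed.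

Lemma sna_gZ (a : R) x : g x -> g (a *: x).
Proof. by move=> gx; have := gL a gx (sna_g0 gx); rewrite addr0. Qed.

Lemma sna_gD x y : g x -> g y -> g (x + y).
Proof. by move=> gx gy; have := gL 1 gx gy; rewrite scale1r. Qed.

Lemma sna_gN x : g x -> g (- x).
Proof. by rewrite -scaleN1r; exact: sna_gZ. Qed.

Ltac mem := repeat first
  [ assumption | apply: gdot | apply: gbr | apply: sna_gD | apply: sna_gZ
  | apply: sna_gN ].

Lemma sna_omD x y z : g x -> g y -> g z -> om (x + y) z = om x z + om y z.
Proof. by move=> *; rewrite -[x in LHS]scale1r oml// mul1r. Qed.

Lemma sna_om0 z : g z -> om 0 z = 0.
Proof.
move=> gz; have g0 := sna_g0 gz.
have := sna_omD g0 g0 gz; rewrite addr0 => /(congr1 (fun t => t - om 0 z)).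
by rewrite subrr addrK.
Qed.

Lemma sna_omZ (a : R) x z : g x -> g z -> om (a *: x) z = a * om x z.
Proof.
move=> gx gz; have := oml a gx (sna_g0 gx) gz.
by rewrite addr0 sna_om0// addr0.
Qed.

Lemma sna_omN x z : g x -> g z -> om (- x) z = - om x z.
Proof. by move=> gx gz; rewrite -scaleN1r sna_omZ// mulN1r. Qed.

Lemma sna_omDr x y z : g x -> g y -> g z -> om z (x + y) = om z x + om z y.
Proof.
by move=> gx gy gz; rewrite omC; mem; rewrite sna_omD// opprD -!omC.
Qed.

Lemma sna_omZr (a : R) x z : g x -> g z -> om z (a *: x) = a * om z x.
Proof.
by move=> gx gz; rewrite omC; mem; rewrite sna_omZ// -mulrN -omC.
Qed.

Lemma sna_omNr x z : g x -> g z -> om z (- x) = - om z x.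
Proof. by move=> gx gz; rewrite -scaleN1r sna_omZr// mulN1r. Qed.

(** Nondegeneracy turns identities between vectors of [g] into scalar identities, which linear
    arithmetic can close. *)
Lemma sna_eq x y : g x -> g y -> (forall z, g z -> om x z = om y z) -> x = y.
Proof.
move=> gx gy xy; apply/eqP; rewrite -subr_eq0; apply/eqP.
apply: (sna_nondeg H); first by mem.
by move=> z gz; rewrite sna_omD ?sna_omN ?xy ?subrr//; mem.
Qed.

Lemma sna_brr (a : R) x y z : g x -> g y -> g z ->
  br z (a *: x + y) = a *: br z x + br z y.
Proof.
by move=> gx gy gz; rewrite brC brl// opprD -scalerN -!brC.
Qed.

Lemma sna_dotl (a b : R) x y z : g x -> g y -> g z ->
  dot (a *: x + b *: y) z = a *: dot x z + b *: dot y z.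
Proof.
move=> gx gy gz; apply: sna_eq; [by mem|by mem|move=> w gw].
have gby : g (b *: y) by mem.
have g0 := sna_g0 gx.
have bry : br (b *: y) w = b *: br y w.
  have br0 : br 0 w = 0.
    by have := brl (-1) gx gx gw; rewrite !scaleN1r !addNr.
  by have := brl b gy g0 gw; rewrite br0 !addr0.
rewrite dotE; [|by mem..].
rewrite brl// bry sna_omDr ?sna_omZr ?sna_omD ?sna_omZ ?dotE//; [|by mem..].
by rewrite opprD !mulrN.
Qed.

Lemma sna_dotr (a b : R) x y z : g x -> g y -> g z ->
  dot z (a *: x + b *: y) = a *: dot z x + b *: dot z y.
Proof.
move=> gx gy gz; apply: sna_eq; [by mem|by mem|move=> w gw].
rewrite dotE; [|by mem..].
rewrite !(sna_omD, sna_omZ, dotE) //; [|by mem..].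
by rewrite opprD !mulrN.
Qed.

(** Paired with [w], this is the closedness identity at x, y, w rewritten by [dotE]. *)
Lemma sna_brE x y : g x -> g y -> br x y = dot x y - dot y x.
Proof.
move=> gx gy; apply: sna_eq; [by mem|by mem|move=> w gw].
have := sna_closed H gx gy gw.
rewrite sna_omD ?sna_omN ?(dotE _ gy) ?(dotE _ gx)//; [|by mem..].
rewrite (omC (gbr gx gw) gy) (omC (gbr gy gw) gx).
lra.
Qed.

Let brE x y : g x -> g y -> br x y = 1 *: dot x y + (-1) *: dot y x.
Proof. by move=> *; rewrite scale1r scaleN1r sna_brE. Qed.

(** By [dotE], L_x is minus the symplectic adjoint of ad_x; left symmetry is thus the Jacobi
    identity for the dual of the adjoint representation. *)
Lemma sna_left_symmetric x y z : g x -> g y -> g z ->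
  dot x (dot y z) - dot y (dot x z) = dot (br x y) z.
Proof.
move=> gx gy gz; apply: sna_eq; [by mem|by mem|move=> w gw].
rewrite sna_omD ?sna_omN; [|by mem..].
rewrite !dotE; [|by mem..].
rewrite (jacobi gx gy gw) sna_omDr; [|by mem..].
lra.
Qed.

(** This is s(w, x; z, y): the left factors of the two products are the first and third arguments,
    the right factors the second and fourth. *)
Let S w z x y := om (dot w z) (dot x y).

Let SC w z x y : g w -> g z -> g x -> g y -> S w z x y = - S x y w z.
Proof. by move=> *; rewrite /S omC//; mem. Qed.

(** It moves a double product into [S], so that the Novikov identity becomes the symmetry of [S] in
    its right factors. *)
Let SE w z x y : g w -> g z -> g x -> g y ->
  om (dot (dot x y) z) w = - S w z x y.
Proof.
by move=> *; rewrite /S !dotE; mem; rewrite brC sna_omNr ?opprK//; mem.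
Qed.

Let Ssym w z x y : g w -> g z -> g x -> g y -> S w z x y = S w y x z.
Proof. by move=> *; apply: oppr_inj; rewrite -!SE// novikov. Qed.

Let Sdot x a b z : g x -> g a -> g b -> g z ->
  om (dot x (dot a b)) z = S a b z x - S a b x z.
Proof.
move=> *; rewrite dotE; mem; rewrite sna_brE// sna_omDr ?sna_omNr /S; mem.
by rewrite opprB.
Qed.

(** Left symmetry of x, a acting on b, paired with z, gives six values of [S]; up to the symmetries
    they form twice the cyclic sum over x, a, z with b fixed. *)
Let Scyc x a z b : g x -> g a -> g z -> g b ->
  S x z a b + S a x z b + S z a x b = 0.
Proof.
move=> gx ga gz gb.
have := congr1 (om^~ z) (sna_left_symmetric gx ga gb).
rewrite /= brE// sna_dotl; mem.
rewrite !(sna_omD, sna_omN, sna_omZ); mem.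
rewrite !Sdot// !SE//.
(* What remains is linear in the values of [S]; these are the instances of its symmetries that
   reduce them to the three in the goal. *)
have e1 := SC ga gb gz gx; have e2 := SC ga gb gx gz.
have e3 := SC gx gb gz ga; have e4 := Ssym gz gx ga gb.
have e5 := Ssym gx gz ga gb; have e6 := Ssym gz ga gx gb.
have e7 := SC gx gb ga gz; have e8 := SC ga gx gz gb.
have e9 := Ssym gz gb ga gx; have e10 := Ssym gz gb gx ga.
have e11 := SC gx gz ga gb; have e12 := Ssym ga gb gx gz.
have e13 := Ssym ga gx gz gb.
lra.
Qed.

Lemma sna_isotropic x y z w : g x -> g y -> g z -> g w ->
  om (br x y) (br z w) = 0.
Proof.
move=> gx gy gz gw; rewrite !sna_brE//.
rewrite !(sna_omD, sna_omN, sna_omDr, sna_omNr); mem.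
rewrite -!/(S _ _ _ _).
(* The goal is the second of these cyclic sums minus the first: the terms s(x, y; z, w) and s(x, y;
   w, z) cancel by symmetry, and the other four are those of the expanded brackets. *)
have := Scyc gx gy gz gw; have := Scyc gx gy gw gz.
have := SC gx gw gy gz; have := SC gx gz gy gw.
have := SC gw gx gy gz; have := SC gz gx gy gw.
have := Ssym gx gy gz gw; have := Ssym gx gy gw gz.
have := Ssym gy gx gz gw; have := Ssym gy gx gw gz.
have := Ssym gy gz gx gw; have := Ssym gz gy gx gw.
have := Ssym gy gw gx gz; have := Ssym gw gy gx gz.
have := SC gy gx gz gw; have := SC gy gx gw gz.
have := SC gz gy gx gw; have := SC gw gy gx gz.
have := SC gz gx gx gw.
lra.
Qed.

(** Paired with [w], the product becomes - om([x,y], [z,w]), which vanishes by isotropy. This is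
    R_[x,y] = 0. *)
Lemma sna_dot_br x y z : g x -> g y -> g z -> dot z (br x y) = 0.
Proof.
move=> gx gy gz; apply: (sna_nondeg H); first by mem.
by move=> w gw; rewrite dotE ?sna_isotropic ?oppr0//; mem.
Qed.

Lemma sna_nabla_closed x y : g x -> g y -> g (sna_nabla dot x y).
Proof. by move=> gx gy; rewrite /sna_nabla; mem. Qed.

Lemma sna_curvature x y z : g x -> g y -> g z ->
  sna_nabla dot x (sna_nabla dot y z) - sna_nabla dot y (sna_nabla dot x z)
    - sna_nabla dot (br x y) z = - (2 / 9 : R) *: br (br x y) z.
Proof.
move=> gx gy gz.
have gxy := gbr gx gy.
apply: sna_eq; [by rewrite /sna_nabla; mem|by mem|move=> w gw].
have Lz := congr1 (om^~ w) (sna_left_symmetric gx gy gz).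
(* Left symmetry with [z] as second argument evaluates the mixed commutators: [L_x, R_y] = R_(x.y) -
   R_y R_x, and likewise with [x] and [y] exchanged. *)
have Lxz := congr1 (om^~ w) (sna_left_symmetric gx gz gy).
have Lyz := congr1 (om^~ w) (sna_left_symmetric gy gz gx).
have N1 := congr1 (om^~ w) (novikov gx gy gz).
have N2 := congr1 (om^~ w) (novikov gy gx gz).
have N3 := congr1 (om^~ w) (novikov gz gx gy).
have I0 := congr1 (om^~ w) (sna_dot_br gx gy gz).
move: Lz Lxz Lyz N1 N2 N3 I0; rewrite /= /sna_nabla.
rewrite !brE; mem.
rewrite !(sna_dotl, sna_dotr); mem.
rewrite !(sna_omD, sna_omN, sna_omZ); mem.
rewrite sna_om0//.
lra.
Qed.

End Algebra.

(** * Traces on a subspace *)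

Section Trace.
Context {R : realType} {V : lmodType R}.
Variable g : set V.
Hypothesis gL : forall (a : R) x y, g x -> g y -> g (a *: x + y).

(** The element [x0] provides 0 in [g], the value of the empty sum; the closure hypothesis alone
    allows [g] to be empty. *)
Lemma basis_span m (e : 'I_m -> V) (a : 'I_m -> R) (x0 : V) : g x0 ->
  basis_of_subspace g e -> g (\sum_i a i *: e i).
Proof.
move=> gx0 [ge _]; have g0 : g 0.
  by have := gL (-1) gx0 gx0; rewrite scaleN1r addNr.
apply: (big_ind g) => // [x y gx gy|i _].
  by have := gL 1 gx gy; rewrite scale1r.
by have := gL (a i) (ge i) g0; rewrite addr0.
Qed.

Lemma basis_inj m (e : 'I_m -> V) (a b : 'I_m -> R) :
  basis_of_subspace g e -> \sum_i a i *: e i = \sum_i b i *: e i -> a =1 b.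
Proof.
move=> eb eab i.
have gs : g (\sum_i a i *: e i) by exact: basis_span (eb.1 i) eb.
have [c [_ cu]] := eb.2 _ gs.
have ca : c = \row_i a i.
  by apply: cu; apply: eq_bigr => j _; rewrite mxE.
have cb : c = \row_i b i.
  by apply: cu; rewrite eab; apply: eq_bigr => j _; rewrite mxE.
by have := congr1 (fun r : 'rV_m => r 0 i) (etrans (esym ca) cb); rewrite !mxE.
Qed.

Lemma basis_coords m (e : 'I_m -> V) p (F : 'I_p -> V) :
  basis_of_subspace g e -> (forall j, g (F j)) ->
  exists A : 'M[R]_(m, p), forall j, F j = \sum_i A i j *: e i.
Proof.
move=> [_ eb] gF.
have /choice[c cE] : forall j, exists c : 'rV[R]_m, F j = \sum_i c 0 i *: e i.
  by move=> j; have [c [cE _]] := eb _ (gF j); exists c.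
exists (\matrix_(i, j) c j 0 i) => j.
by rewrite cE; apply: eq_bigr => i _; rewrite mxE.
Qed.

Lemma basis_mulmx m p q (e : 'I_m -> V) (A : 'M[R]_(m, p))
    (B : 'M[R]_(p, q)) j :
  \sum_k B k j *: \sum_i A i k *: e i = \sum_i (A *m B) i j *: e i.
Proof.
under eq_bigr => k _ do rewrite scaler_sumr.
rewrite exchange_big; apply: eq_bigr => i _; rewrite mxE scaler_suml.
by apply: eq_bigr => k _; rewrite scalerA mulrC.
Qed.

Lemma basis_mx_inj m p (e : 'I_m -> V) (A B : 'M[R]_(m, p)) :
  basis_of_subspace g e ->
  (forall j, \sum_i A i j *: e i = \sum_i B i j *: e i) -> A = B.
Proof. by move=> eb AB; apply/matrixP => i j; exact: basis_inj eb (AB j) i. Qed.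

Definition linear_on (F : V -> V) : Prop :=
  (forall (a : R) x y, g x -> g y -> F (a *: x + y) = a *: F x + F y) /\
  (forall x, g x -> g (F x)).

Lemma linear_on_sum F m (e : 'I_m -> V) (a : 'I_m -> R) (x0 : V) : g x0 ->
  linear_on F -> basis_of_subspace g e ->
  F (\sum_i a i *: e i) = \sum_i a i *: F (e i).
Proof.
move=> gx0 [FL _] [ge _]; have g0 : g 0.
  by have := gL (-1) gx0 gx0; rewrite scaleN1r addNr.
have F0 : F 0 = 0.
  by have := FL (-1) _ _ gx0 gx0; rewrite !scaleN1r !addNr.
suff [] : g (\sum_i a i *: e i) /\
    F (\sum_i a i *: e i) = \sum_i a i *: F (e i) by [].
apply: (big_ind2 (fun x y => g x /\ F x = y)) => // [x y x' y'|i _].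
  move=> [gx <-] [gx' <-]; split; first by have := gL 1 gx gx'; rewrite scale1r.
  by have := FL 1 _ _ gx gx'; rewrite !scale1r.
split; first by have := gL (a i) (ge i) g0; rewrite addr0.
by have := FL (a i) _ _ (ge i) g0; rewrite F0 !addr0.
Qed.

(** The change-of-basis matrices [P] and [Q] are mutually inverse and satisfy A P = P A', so tr A =
    tr (P A' Q) = tr A'. They may be rectangular a priori, so equality of the two basis sizes never
    enters. *)
Lemma has_trace_uniq F t t' : linear_on F ->
  has_trace g F t -> has_trace g F t' -> t = t'.
Proof.
move=> FL [m [e [A [eb FA ->]]]] [p [e' [A' [eb' FA' ->]]]].
have [P PE] := basis_coords eb eb'.1.
have [Q QE] := basis_coords eb' eb.1.
have PQ : P *m Q = 1%:M.
  apply: (basis_mx_inj eb) => j; rewrite -basis_mulmx.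
  under eq_bigr => k _ do rewrite -PE.
  rewrite -QE (bigD1 j)//= mxE eqxx scale1r big1 ?addr0// => i /negPf ij.
  by rewrite mxE ij scale0r.
have QP : Q *m P = 1%:M.
  apply: (basis_mx_inj eb') => j; rewrite -basis_mulmx.
  under eq_bigr => k _ do rewrite -QE.
  rewrite -PE (bigD1 j)//= mxE eqxx scale1r big1 ?addr0// => i /negPf ij.
  by rewrite mxE ij scale0r.
have APE : A *m P = P *m A'.
  apply: (basis_mx_inj eb) => j; rewrite -!basis_mulmx.
  under eq_bigr => k _ do rewrite -FA.
  under [RHS]eq_bigr => k _ do rewrite -PE.
  rewrite -FA' PE; have gj := eb'.1 j.
  by rewrite (linear_on_sum _ gj FL eb).
by rewrite -[A]mulmx1 -PQ mulmxA APE mxtrace_mulC mulmxA QP mul1mx.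
Qed.

Lemma trace_onE F t : linear_on F -> has_trace g F t -> trace_on g F = t.
Proof.
move=> FL Ft; apply: xget_unique => // t' Ft'.
exact: has_trace_uniq FL Ft' Ft.
 Qed.

Lemma trace_on_eq F F' : (forall x, g x -> F x = F' x) ->
  trace_on g F = trace_on g F'.
Proof.
move=> FF'; rewrite /trace_on; congr (xget 0 _); apply/funext => t.
apply/propext; split=> -[m [e [A [eb FA tA]]]]; exists m, e, A; split=> // j.
  by rewrite -FF' ?FA//; exact: eb.1.
by rewrite FF' ?FA//; exact: eb.1.
Qed.

(** In a finite basis this is tr (A2 A1) = tr (A1 A2). The other case is kept, so that finite
    dimensionality of the Lie algebra need not be established. *)
Lemma trace_on_comp (c : R) L1 L2 : linear_on L1 -> linear_on L2 ->
  trace_on g (fun x => c *: L2 (L1 x)) = c * trace_on g (L1 \o L2).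
Proof.
move=> lin1 lin2.
have lincomp L L' : linear_on L -> linear_on L' -> linear_on (L \o L').
  move=> [LL gL1] [LL' gL1']; split=> [a x y gx gy|x gx] /=.
    by rewrite LL' ?LL//; exact: gL1'.
  by apply/gL1/gL1'.
have [[m [e eb]]|nb] := pselect
  (exists m (e : 'I_m -> V), basis_of_subspace g e).
  have [A1 A1E] := basis_coords eb (fun j => lin1.2 _ (eb.1 j)).
  have [A2 A2E] := basis_coords eb (fun j => lin2.2 _ (eb.1 j)).
  have compE L L' (A A' : 'M[R]_m) : linear_on L ->
      (forall j, L (e j) = \sum_i A i j *: e i) ->
      (forall j, L' (e j) = \sum_i A' i j *: e i) ->
      forall j, L (L' (e j)) = \sum_i (A *m A') i j *: e i.
    move=> lL LE LE' j; rewrite LE' (linear_on_sum _ (eb.1 j) lL eb).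
    under eq_bigr => k _ do rewrite LE.
    exact: basis_mulmx.
  have T12 : has_trace g (L1 \o L2) (\tr (A1 *m A2)).
    by exists m, e, (A1 *m A2); split=> //; exact: compE lin1 A1E A2E.
  have T21 : has_trace g (fun x => c *: L2 (L1 x)) (\tr (c *: (A2 *m A1))).
    exists m, e, (c *: (A2 *m A1)); split=> // j.
    rewrite (compE _ _ _ _ lin2 A2E A1E) scaler_sumr.
    by apply: eq_bigr => i _; rewrite scalerA [in RHS]mxE.
  have lin21 : linear_on (fun x => c *: L2 (L1 x)).
    have [L21 g21] := lincomp _ _ lin2 lin1.
    split=> [a x y gx gy|x gx] /=.
      have /= -> := L21 a x y gx gy.
      by rewrite scalerDr !scalerA mulrC.
    (* Closure is stated for a x + y only, so the multiple by [c] is written as (c - 1) y + y. *)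
    have := gL (c - 1) (g21 x gx) (g21 x gx).
    by rewrite -[X in _ + X]scale1r -scalerDl subrK.
  rewrite (trace_onE lin21 T21) (trace_onE (lincomp _ _ lin1 lin2) T12).
  by rewrite mxtraceZ mxtrace_mulC.
(* Without a finite basis both traces take their conventional value 0. *)
have nt F : trace_on g F = 0.
  rewrite /trace_on xgetPN// => t [m [e [A [eb _ _]]]].
  by apply: nb; exists m, e.
by rewrite !nt mulr0.
Qed.

End Trace.

(** * The Lie algebra of left-invariant fields *)

Lemma derive_lin_dir (R : realType) (V W : normedModType R) (f : V -> W)
    (a : R) v w x : differentiable f x ->
  'D_(a *: v + w) f x = a *: 'D_v f x + 'D_w f x.
Proof. by move=> df; rewrite !deriveE// linearP. Qed.

(** The product rule on the sum of b_i D_i F, followed by [derive_swap]. It separates the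
    first-order term from a second-order term that is symmetric in [v] and [b u]. *)
Lemma derive_vector_coef (R : realType) n (U : set 'rV[R]_n)
    (F : 'rV[R]_n -> R) (b : 'rV[R]_n -> 'rV[R]_n) u v :
  open U -> U u -> Cdiff 2 U F -> differentiable b u ->
  'D_v (fun y => 'D_(b y) F y) u = 'D_('D_v b u) F u + 'D_(b u) ('D_v F) u.
Proof.
move=> oU Uu CF db.
have dF y : U y -> differentiable F y by exact: Cdiff_differentiable CF y.
have dDF w y : U y -> differentiable ('D_w F) y.
  by exact: Cdiff_differentiable (Cdiff_derive w CF) y.
pose T i : 'rV[R]_n -> R := (fun y => b y 0 i) * 'D_(delta_mx 0 i) F.
transitivity ('D_v (\sum_i T i) u).
  apply: near_eq_derive; apply: filterS (open_nbhs_nbhs (conj oU Uu)) => y Uy.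
  by rewrite derive_sum_delta ?fct_sumE//; exact: dF.
have dbi i : derivable (fun y => b y 0 i : R) u v.
  exact/diff_derivable/differentiable_coords.
have dFi i : derivable ('D_(delta_mx 0 i) F) u v.
  exact/diff_derivable/dDF.
rewrite derive_sum; last by move=> i; exact: derivableM.
rewrite (derive_sum_delta _ (dF u Uu)) (derive_sum_delta _ (dDF v u Uu)).
rewrite -big_split; apply: eq_bigr => i _.
rewrite deriveM// derive_coord// (derive_swap _ _ oU Uu CF) addrC.
by congr (_ + _); exact: mulrC.
Qed.

Section VectorFields.
Context {R : realType} {n : nat} (G : lieGroup R n).
Implicit Types (f h : func G) (X Y Z : vfield G) (p q g : G).

Definition field_coef (c : chart R n G) X (a : 'rV[R]_n -> 'rV[R]_n) : Prop :=
  smooth_on (chart_cod c) a /\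
  forall f u, smooth f -> chart_cod c u ->
    X f (chart_inv c u) = 'D_(a u) (f \o chart_inv c) u.

Lemma field_coef_smooth c X a k : field_coef c X a -> Cdiff k (chart_cod c) a.
Proof. by move=> [/smooth_onP]. Qed.

Lemma field_smooth X f : vector_field X -> smooth f -> smooth (X f : func G).
Proof.
move=> [_ XP] sf; apply/smoothP => c ac k; have [a aX] := XP c ac.
have Cf j : Cdiff j (chart_cod c) (f \o chart_inv c : _ -> R).
  by move/smoothP: sf; exact.
have C i : Cdiff k (chart_cod c)
    ((fun u => a u 0 i : R) * 'D_(delta_mx 0 i) (f \o chart_inv c : _ -> R)).
  apply: (CdiffM (open_chart_cod c)); last exact: Cdiff_derive (Cf k.+1).
  exact/(Cdiff_coord _ (open_chart_cod c))/field_coef_smooth/aX.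
apply: (Cdiff_eq (open_chart_cod c)) (Cdiff_sum (open_chart_cod c) C) => u cu.
rewrite /= aX.2// fct_sumE derive_sum_delta//.
exact: smooth_differentiable.
Qed.

Lemma fieldL X (a : R) f h : vector_field X -> smooth f -> smooth h ->
  X (a *: (f : G -> R^o) + h) = a *: X f + X h.
Proof.
move=> [_ XP] sf sh; apply/funext => p.
have [c ac cp] := atlas_chart p; have [b [_ bX]] := XP c ac.
have cu := chart_cod_map cp.
rewrite -(chart_mapK cp) bX//; last by apply: smoothD => //; exact: smoothZ.
have df := smooth_differentiable sf ac cu.
have dh := smooth_differentiable sh ac cu.
transitivity ('D_(b (chart_map c p))
    (a *: (f \o chart_inv c : _ -> R) + (h \o chart_inv c : _ -> R))
    (chart_map c p)); first by [].
rewrite deriveD ?deriveZ.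
- by rewrite -!bX.
- exact: diff_derivable.
- exact/derivableZ/diff_derivable.
- exact: diff_derivable.
Qed.

Lemma field_cst X (a : R) : vector_field X -> X (cst a) = 0.
Proof.
move=> [_ XP]; apply/funext => p.
have [c ac cp] := atlas_chart p; have [b [_ bX]] := XP c ac.
rewrite -(chart_mapK cp) bX; [|exact: smooth_cst|exact: chart_cod_map].
exact: derive_cst.
Qed.

Lemma field0 X : vector_field X -> X 0 = 0.
Proof. by move=> /(field_cst 0). Qed.

Lemma fieldB X f h : vector_field X -> smooth f -> smooth h ->
  X (f - h) = X f - X h.
Proof.
move=> vX sf sh; have := fieldL (-1) vX sh sf.
by rewrite !scaleN1r addrC => ->; rewrite addrC.
Qed.

Lemma vector_fieldL (a : R) X Y : vector_field X -> vector_field Y ->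
  vector_field (a *: X + Y).
Proof.
move=> [X0 XP] [Y0 YP]; split=> [f nsf|c ac].
  by rewrite -[LHS]/(a *: X f + Y f) X0// Y0// scaler0 addr0.
have [b bX] := XP c ac; have [d dY] := YP c ac.
exists (fun u => a *: b u + d u); split.
  apply/smooth_onP => k.
  have oc := open_chart_cod c.
  apply: (CdiffD oc); last exact: field_coef_smooth dY.
  apply: (Cdiff_row oc) => i.
  have Cb := Cdiff_coord i oc (field_coef_smooth k bX).
  apply: (Cdiff_eq oc) (CdiffM oc (Cdiff_cst _ _ a) Cb) => u _.
  by rewrite mxE.
move=> f u sf cu.
rewrite derive_lin_dir; last exact: smooth_differentiable.
by rewrite -bX.2// -dY.2.
Qed.

(** In a chart the coefficients are D_a b - D_b a, since the second-order terms of the two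
    compositions cancel by [derive_swap]. Each coefficient costs one order of differentiability,
    whence [k.+1] in [CD]. *)
Lemma vector_field_bracket X Y : vector_field X -> vector_field Y ->
  vector_field (bracket X Y).
Proof.
move=> vX vY; have [X0 XP] := vX; have [Y0 YP] := vY.
split=> [f nsf|c ac].
  by rewrite /bracket (X0 f nsf) (Y0 f nsf) (field0 vX) (field0 vY) subrr.
have [a aX] := XP c ac; have [b bY] := YP c ac.
have oc := open_chart_cod c.
pose D (a b : 'rV[R]_n -> 'rV[R]_n) u := 'D_(a u) b u.
have CD a' b' (k : nat) : Cdiff k (chart_cod c) a' ->
    Cdiff k.+1 (chart_cod c) b' -> Cdiff k (chart_cod c) (D a' b').
  move=> Ca Cb; apply: (Cdiff_row oc) => i.
  have C j : Cdiff k (chart_cod c) ((fun u => a' u 0 j : R) *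
      (fun u => ('D_(delta_mx 0 j) b' u) 0 i : R)).
    apply: (CdiffM oc); first exact: (Cdiff_coord _ oc).
    exact: (Cdiff_coord _ oc (Cdiff_derive _ Cb)).
  apply: (Cdiff_eq oc) (Cdiff_sum oc C) => u cu.
  rewrite /D derive_sum_delta; last exact: Cdiff_differentiable Cb u cu.
  by rewrite summxE fct_sumE; apply: eq_bigr => j _; rewrite mxE.
exists (fun u => -1 *: D b a u + D a b u); split.
  apply/smooth_onP => k; apply: (CdiffD oc); last first.
    by apply: CD; [exact: field_coef_smooth aX|exact: field_coef_smooth bY].
  apply: (Cdiff_row oc) => i.
  have CDi := Cdiff_coord i oc
    (CD _ _ k (field_coef_smooth k bY) (field_coef_smooth k.+1 aX)).
  apply: (Cdiff_eq oc) (CdiffM oc (Cdiff_cst _ _ (-1 : R)) CDi) => u _.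
  by rewrite mxE.
move=> f u sf cu.
set F : 'rV[R]_n -> R := f \o chart_inv c.
have CF : Cdiff 2 (chart_cod c) F by move/smoothP: sf; exact.
have dF : differentiable F u := Cdiff_differentiable CF cu.
have second X' Y' a' b' : vector_field X' -> vector_field Y' ->
    field_coef c X' a' -> field_coef c Y' b' ->
    X' (Y' f) (chart_inv c u) =
    'D_('D_(a' u) b' u) F u + 'D_(b' u) ('D_(a' u) F) u.
  move=> vX' vY' aX' bY'; rewrite aX'.2//; last exact: field_smooth.
  rewrite -(derive_vector_coef _ oc cu CF); last exact: (bY'.1 [::]).
  apply: near_eq_derive.
  apply: filterS (open_nbhs_nbhs (conj oc cu)) => y cy.
  by rewrite /= bY'.2.
have XY := second X Y a b vX vY aX bY; have YX := second Y X b a vY vX bY aX.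
have sw : 'D_(b u) ('D_(a u) F) u = 'D_(a u) ('D_(b u) F) u.
  exact: derive_swap oc cu CF.
have aux (r s t : R) : r + t - (s + t) = -1 * s + r by ring.
apply: etrans (esym (derive_lin_dir (-1) (D b a u) (D a b u) dF)).
apply: etrans (congr2 (fun s t : R => s - t) XY YX) _.
by move: sw; move:
  ('D_(b u) _ u) ('D_(a u) ('D_(b u) F) u) => s t ->; exact: aux.
Qed.

Lemma lie_algebra_vector_field X : lie_algebra X -> vector_field X.
Proof. by case. Qed.

Lemma lie_algebraL (a : R) X Y : lie_algebra X -> lie_algebra Y ->
  lie_algebra (a *: X + Y).
Proof.
move=> [vX lX] [vY lY]; split=> [|g]; first exact: vector_fieldL.
by rewrite -[LHS]/(a *: lpush g X + lpush g Y) lX lY.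
Qed.

Lemma lie_algebra_ltrans X g f p : lie_algebra X ->
  X (f \o ltrans g) p = X f (g * p)%g.
Proof.
move=> [_ /(_ g)/(congr1 (fun Z => Z f (g * p)%g)) <-].
by rewrite /lpush mulKg.
Qed.

Lemma lie_algebra_bracket X Y : lie_algebra X -> lie_algebra Y ->
  lie_algebra (bracket X Y).
Proof.
move=> lX lY; split=> [|g].
  by apply: vector_field_bracket; exact: lie_algebra_vector_field.
have XE Z f : lie_algebra Z -> Z (f \o ltrans g) = Z f \o ltrans g.
  by move=> lZ; apply/funext => p; rewrite lie_algebra_ltrans.
apply/funext => f; apply/funext => p.
rewrite /lpush -[LHS]/(X (Y (f \o ltrans g)) (g^-1 * p)%g -
  Y (X (f \o ltrans g)) (g^-1 * p)%g).
by rewrite !XE//= /ltrans mulVKg.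
Qed.

Lemma bracketC X Y : bracket X Y = - bracket Y X.
Proof.
by apply/funext => f; rewrite -[RHS]/(- (bracket Y X f)) /bracket opprB.
Qed.

Lemma bracketL (a : R) X Y Z :
  vector_field X -> vector_field Y -> vector_field Z ->
  bracket (a *: X + Y) Z = a *: bracket X Z + bracket Y Z.
Proof.
move=> vX vY vZ; have vXY := vector_fieldL a vX vY.
apply/vfield_eq => f sf.
  rewrite (vector_field_bracket vXY vZ).1//.
  rewrite -[RHS]/(a *: bracket X Z f + bracket Y Z f).
  by rewrite !(vector_field_bracket _ vZ).1// scaler0 addr0.
rewrite -[RHS]/(a *: bracket X Z f + bracket Y Z f) /bracket.
rewrite -[(a *: X + Y) f]/(a *: X f + Y f).
rewrite fieldL//; [|exact: field_smooth..].
rewrite -[(a *: X + Y) (Z f)]/(a *: X (Z f) + Y (Z f)).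
by rewrite scalerBr opprD addrACA.
Qed.

Lemma bracket_jacobi X Y Z :
  vector_field X -> vector_field Y -> vector_field Z ->
  bracket X (bracket Y Z) = bracket (bracket X Y) Z + bracket Y (bracket X Z).
Proof.
move=> vX vY vZ.
have vb := @vector_field_bracket; have fs := @field_smooth.
apply/vfield_eq => f sf.
  rewrite (vb _ _ vX (vb _ _ vY vZ)).1//.
  rewrite -[RHS]/(bracket (bracket X Y) Z f + bracket Y (bracket X Z) f).
  rewrite (vb _ _ (vb _ _ vX vY) vZ).1// (vb _ _ vY (vb _ _ vX vZ)).1//.
  by rewrite addr0.
rewrite -[RHS]/(bracket (bracket X Y) Z f + bracket Y (bracket X Z) f).
have E1 : X (bracket Y Z f) = X (Y (Z f)) - X (Z (Y f)).
  exact: fieldB vX (fs _ _ vY (fs _ _ vZ sf)) (fs _ _ vZ (fs _ _ vY sf)).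
have E2 : Z (bracket X Y f) = Z (X (Y f)) - Z (Y (X f)).
  exact: fieldB vZ (fs _ _ vX (fs _ _ vY sf)) (fs _ _ vY (fs _ _ vX sf)).
have E3 : Y (bracket X Z f) = Y (X (Z f)) - Y (Z (X f)).
  exact: fieldB vY (fs _ _ vX (fs _ _ vZ sf)) (fs _ _ vZ (fs _ _ vX sf)).
have aux (a b c d e k : R) :
  a - b - (c - d) = a - e - (k - d) + (e - c - (b - k)) by ring.
rewrite -[LHS]/(X (bracket Y Z f) - bracket Y Z (X f)).
rewrite -[bracket (bracket X Y) Z f]/(bracket X Y (Z f) - Z (bracket X Y f)).
rewrite -[bracket Y (bracket X Z) f]/(Y (bracket X Z f) - bracket X Z (Y f)).
by rewrite E1 E2 E3; apply/funext => p; exact: aux.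
Qed.

Lemma at_point_ltrans X g p : lie_algebra X ->
  dltrans g (at_point X p) = at_point X (g * p)%g.
Proof.
by move=> lX; apply/funext => f; rewrite /dltrans /at_point lie_algebra_ltrans.
Qed.

(** * The symplectic form and the tensor N on left-invariant fields *)

Section Form.
Variable om : form2 G.
Hypothesis om_symplectic : symplectic_form om.

Lemma eval2L (a : R) X Y Z p :
  vector_field X -> vector_field Y -> vector_field Z ->
  eval2 om (a *: X + Y) Z p = a * eval2 om X Z p + eval2 om Y Z p.
Proof.
move=> vX vY vZ; have [[omL _ _ _] _ _] := om_symplectic.
by rewrite -omL//; exact: vector_field_tangent.
Qed.

Lemma eval2R (a : R) X Y Z p :
  vector_field X -> vector_field Y -> vector_field Z ->
  eval2 om Z (a *: X + Y) p = a * eval2 om Z X p + eval2 om Z Y p.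
Proof.
move=> vX vY vZ; have [[_ omR _ _] _ _] := om_symplectic.
by rewrite -omR//; exact: vector_field_tangent.
Qed.

Lemma eval2C X Y p : vector_field X -> vector_field Y ->
  eval2 om X Y p = - eval2 om Y X p.
Proof.
move=> vX vY; have [[_ _ omA _] _ _] := om_symplectic.
have A Z : vector_field Z -> eval2 om Z Z p = 0.
  by move=> vZ; apply: omA; exact: vector_field_tangent.
have vXY := vector_fieldL 1 vX vY.
have := A _ vXY; rewrite eval2L// !eval2R// !A//; lra.
Qed.

(** Nondegeneracy at each point, combined with the fact that left-invariant fields fill every
    tangent space. *)
Lemma vector_field_eqP X Y : vector_field X -> vector_field Y ->
  (forall Z p, lie_algebra Z -> eval2 om X Z p = eval2 om Y Z p) -> X = Y.
Proof.
move=> vX vY XY; have [_ _ nd] := om_symplectic.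
have vYX := vector_fieldL (-1) vY vX.
have YX p : at_point (-1 *: Y + X) p = 0.
  apply: nd; first exact: vector_field_tangent.
  move=> w /left_field_extension[Z lZ <-].
  have vZ := lie_algebra_vector_field lZ.
  by have := eval2L (-1) p vY vX vZ; rewrite XY// mulN1r addNr.
apply/funext => f; apply/funext => p.
have := congr1 (fun v => v f) (YX p).
rewrite -[LHS]/(-1 * Y f p + X f p) mulN1r => /eqP.
by rewrite addrC subr_eq0 => /eqP.
Qed.

Hypothesis om_invariant : left_invariant_form om.

(** Translation by [p] carries the values at the unit to those at [p]. The function is therefore
    constant and every field annihilates it. *)
Lemma eval2_lie_algebra X Y p : lie_algebra X -> lie_algebra Y ->
  eval2 om X Y p = omega_e om X Y.
Proof.
move=> lX lY; rewrite /omega_e -(om_invariant p); last 2 first.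
- exact/vector_field_tangent/lie_algebra_vector_field.
- exact/vector_field_tangent/lie_algebra_vector_field.
by rewrite !at_point_ltrans// mulg1.
Qed.

Lemma field_eval2 X Y Z : vector_field X -> lie_algebra Y -> lie_algebra Z ->
  X (eval2 om Y Z) = 0.
Proof.
move=> vX lY lZ.
have -> : eval2 om Y Z = cst (omega_e om Y Z).
  by apply/funext => p; rewrite eval2_lie_algebra.
exact: field_cst.
Qed.

Lemma lie_algebra_symplectic_novikov dot :
  left_symmetric_product om dot -> novikov dot ->
  symplectic_novikov_algebra (@lie_algebra R n G) (@bracket R n G) dot
    (omega_e om).
Proof.
move=> dotP nov; have lv := lie_algebra_vector_field.
split.
- exact: lie_algebraL.
- exact: lie_algebra_bracket.
- by move=> x y lx ly; case: (dotP x y lx ly).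
- exact: bracketC.
- by move=> a x y z /lv vx /lv vy /lv vz; exact: bracketL.
- by move=> x y z /lv vx /lv vy /lv vz; exact: bracket_jacobi.
- by move=> a x y z /lv vx /lv vy /lv vz; exact: (eval2L a 1%g vx vy vz).
- by move=> x y /lv vx /lv vy; exact: (eval2C 1%g vx vy).
- move=> x lx x0.
  have v0 : vector_field (0 : vfield G).
    by have := vector_fieldL (-1) (lv _ lx) (lv _ lx); rewrite scaleN1r addNr.
  apply: vector_field_eqP => [||z p lz]; [exact: lv|exact: v0|].
  have l0 : lie_algebra (0 : vfield G).
    by have := lie_algebraL (-1) lx lx; rewrite scaleN1r addNr.
  rewrite !eval2_lie_algebra// x0//.
  have := eval2L (-1) 1%g (lv _ lx) (lv _ lx) (lv _ lz).
  by rewrite scaleN1r addNr mulN1r addNr => <-.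
- move=> x y z lx ly lz; have [_ cl _] := om_symplectic.
  have := congr1 (fun f => f 1%g) (cl x y z (lv _ lx) (lv _ ly) (lv _ lz)).
  (* The three derivative terms of closedness vanish; the bracket terms remain. *)
  rewrite (field_eval2 (lv _ lx) ly lz) (field_eval2 (lv _ ly) lx lz).
  rewrite (field_eval2 (lv _ lz) lx ly).
  move=> E.
  have {}E : 0 - 0 + 0 - omega_e om (bracket x y) z
      + omega_e om (bracket x z) y - omega_e om (bracket y z) x = 0 := E.
  lra.
- by move=> x y z lx ly lz; have [_ ->] := dotP x y lx ly.
- exact: nov.
Qed.

(** The derivative term vanishes on left-invariant fields, so om(N(x,y), z) = - om(x.y, z) - om(y,
    x.z). The definition of the product turns the right side into om([x,y], z) - om([x,z], y), which
    closedness identifies with om(x, [y,z]) = - om(y.x, z). *)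
Lemma N_tensor_lie_algebra dot nabla N x y :
  left_symmetric_product om dot -> novikov dot -> affine_structure dot nabla ->
  N_tensor om nabla N -> lie_algebra x -> lie_algebra y ->
  N x y = - dot y x.
Proof.
move=> dotP nov [_ _ nablaE] NP lx ly; have lv := lie_algebra_vector_field.
have H := lie_algebra_symplectic_novikov dotP nov.
have [vN NE] := NP x y (lv _ lx) (lv _ ly).
have lyx : lie_algebra (dot y x) by exact: sna_dot H _ _ ly lx.
have lxy : lie_algebra (dot x y) by exact: sna_dot H _ _ lx ly.
have lNyx : lie_algebra (- dot y x) := sna_gN H lyx.
apply: vector_field_eqP => [//||z p lz]; first exact: lv.
have lxz : lie_algebra (dot x z) by exact: sna_dot H _ _ lx lz.
have := congr1 (fun f => f p) (NE z (lv _ lz)); rewrite /cov_deriv_form.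
rewrite !nablaE// field_eval2//; last exact: lv.
rewrite sub0r => <-.
rewrite -[LHS]/(- eval2 om (dot x y) z p - eval2 om y (dot x z) p).
rewrite !eval2_lie_algebra// (sna_omN H)//.
have br := sna_br H.
have e1 := sna_dotE H lx ly lz; have e2 := sna_dotE H ly lx lz.
have e3 := sna_dotE H lx lz ly; have e4 := sna_omC H ly lxz.
have e5 := sna_omC H (br _ _ lx ly) lz; have e6 := sna_omC H (br _ _ lx lz) ly.
have e7 := sna_omC H (br _ _ ly lz) lx; have e8 := sna_closed H lx ly lz.
lra.
Qed.

End Form.
End VectorFields.

(** * Curvature and Ricci tensor of the symplectic connection *)

Lemma symplectic_connection_lie_algebra (R : realType) (n : nat)
    (G : lieGroup R n) (om : form2 G)
    (dot nabla N : vfield G -> vfield G -> vfield G)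
    (x y : vfield G) :
  symplectic_form om -> left_invariant_form om ->
  left_symmetric_product om dot -> novikov dot -> affine_structure dot nabla ->
  N_tensor om nabla N -> lie_algebra x -> lie_algebra y ->
  symplectic_connection nabla N x y = sna_nabla dot x y.
Proof.
move=> omS omI dotP nov aff NP lx ly.
have NE := N_tensor_lie_algebra omS omI dotP nov aff NP.
have [_ _ nablaE] := aff.
rewrite /symplectic_connection (NE x y)// (NE y x)// nablaE// /sna_nabla.
rewrite addrAC !scalerN scaleNr; congr (_ - _).
rewrite -[X in X - _]scale1r -scalerBl; congr (_ *: _).
by field.
Qed.

Theorem theorem4 (R : realType) (n : nat) (G : lieGroup R n) (om : form2 G)
    (dot nabla N : vfield G -> vfield G -> vfield G)
    (om_symplectic : symplectic_form om)
    (om_invariant : left_invariant_form om)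
    (dot_product : left_symmetric_product om dot)
    (dot_novikov : novikov dot)
    (nabla_affine : affine_structure dot nabla)
    (N_def : N_tensor om nabla N) :
  [/\ forall x y z : vfield G,
        lie_algebra x -> lie_algebra y -> lie_algebra z ->
        curvature (symplectic_connection nabla N) x y z
          = - (2%:R / 9%:R : R) *: ad (ad x y) z,
      flat (symplectic_connection nabla N) <-> two_step_nilpotent G &
      forall x y : vfield G, lie_algebra x -> lie_algebra y ->
        ricci (symplectic_connection nabla N) x y
          = 2%:R / 9%:R * trace_on (@lie_algebra R n G) (ad x \o ad y)].
Proof.
have H := lie_algebra_symplectic_novikov om_symplectic om_invariant
  dot_product dot_novikov.
have br := sna_br H.
have nablaE x y := @symplectic_connection_lie_algebra _ _ _ _ _ _ _ x y
  om_symplectic om_invariant dot_product dot_novikov nabla_affine N_def.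
have K x y z : lie_algebra x -> lie_algebra y -> lie_algebra z ->
    curvature (symplectic_connection nabla N) x y z
      = - (2%:R / 9%:R : R) *: ad (ad x y) z.
  (* The inner covariant derivatives stay left-invariant, so the algebraic formula also applies to
     the outer ones. *)
  move=> lx ly lz; have lnabla := sna_nabla_closed H.
  rewrite -[RHS](sna_curvature H lx ly lz) /curvature.
  rewrite (nablaE y z)// (nablaE x z)// (nablaE (bracket x y) z)//;
    last exact: br.
  by rewrite (nablaE x)// ?(nablaE y)//; exact: lnabla.
split=> //.
- split=> [fl x y z lx ly lz|nil x y z lx ly lz].
    have := fl x y z lx ly lz; rewrite K// => /eqP.
    rewrite scaler_eq0 oppr_eq0 mulf_eq0 invr_eq0 !pnatr_eq0/= => /eqP.
    exact.
  by rewrite K// /ad (nil x y z) ?scaler0.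
move=> x y lx ly; rewrite /ricci.
have lin X : lie_algebra X -> linear_on (@lie_algebra R n G) (ad X).
  by move=> lX; split=> [a u v lu lv|u lu]; [exact: (sna_brr H)|exact: br].
(* Cyclicity reverses the composition to ad_y o ad_x, as in K(x, z) y = - 2/9 [[x,z], y] = 2/9 [y,
   [x,z]]; the sign comes from antisymmetry. *)
rewrite -(trace_on_comp (@lie_algebraL _ _ G) _ (lin x lx) (lin y ly)).
apply: trace_on_eq => z lz; rewrite K// /ad (bracketC (bracket x z)).
by rewrite scalerN scaleNr opprK.
Qed.
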